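(* Let $B$ be a compact integral affine manifold. If $B$ admits a non-zero tropical $p$-form, i.e. a non-zero element of $H^0(B;\wedge^p T^*_{\mathbb Z}B)$, for some $p\ge 2$, then $\mathrm{CH}_0(B)_{\hom}$ is infinite-dimensional; that is, for every $k\in\mathbb N$ the map $$B^k\times B^k\to \mathrm{CH}_0(B)_{\hom},\qquad (\mathbf b^+,\mathbf b^-)\mapsto \sum_{i=1}^k\big([b_i^+]-[b_i^-]\big)$$ is not surjective.
   Context: An integral affine (= tropical affine) manifold is a smooth manifold $B$ of dimension $n$ with an atlas whose transition functions lie in $\mathrm{Aff}_{\mathbb Z}(\mathbb R^n)=\mathbb R^n\rtimes \mathrm{GL}(n,\mathbb Z)$ (maps $x\mapsto Ax+x_0$ with $A\in\mathrm{GL}(n,\mathbb Z)$, $x_0\in\mathbb R^n$); equivalently, with an integrable lattice $T_{\mathbb Z}B\subset TB$. $T^*_{\mathbb Z}B$ is the local system of $1$-forms taking integer values on $T_{\mathbb Z}B$, and $\wedge^pT^*_{\mathbb Z}B$ is its $p$-th exterior power; its global sections are called tropical $p$-forms. Abstract tropical curve: a finite graph $\Gamma$ (not necessarily connected), possibly with semi-infinite edges (having exactly one end vertex; edges infinite in both directions are not allowed), without $1$-valent vertices, each edge $e$ being equipped with an integral affine structure ($T_{\mathbb Z}e\subset Te$) whose induced metric is complete, i.e. bounded edges are modelled on $[0,\ell]$ and semi-infinite edges on $[0,\infty)$. A parametrized tropical curve in an integral affine manifold $M$ (possibly non-compact) is an abstract tropical curve $\Gamma$ with a proper embedding $h:\Gamma\to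 M$ such that $h$ is integer affine on each edge ($dh(T_{\mathbb Z}e)\subset T_{\mathbb Z}M$) and at each vertex $v$ the balancing condition $\sum_{e\to v}dh(z_e)=0$ holds, the sum being over edges $e$ ending at $v$, with $z_e\in T_{\mathbb Z,v}e$ primitive and pointing outwards from $v$. The weight $w_e$ of an edge is the positive integer with $dh(z_e)=w_eu_e$, $u_e\in T_{\mathbb Z}M$ primitive. For compact $B$, a parametrized tropical curve $h:\Gamma\to B\times\mathbb R$ is horizontal at infinity if $\mathrm{pr}_B\circ h$ is constant on each semi-infinite edge. Let $E_{\pm\infty}$ be the sets of semi-infinite edges asymptotic to $B\times\{\pm\infty\}$, and $b_e\in B$ the constant value of $\mathrm{pr}_B\circ h$ on such an edge $e$. Balancing implies $\sum_{e\in E_{+\infty}}w_e=\sum_{e\in E_{-\infty}}w_e$. Let $Z_0(B)$ be the free abelian group on the points of $B$, and $R_0(B)\subset Z_0(B)$ the subgroup generated by all $\sum_{e\in E_{+\infty}}w_e b_e-\sum_{e\in E_{-\infty}}w_e b_e$, for all parametrized tropical curves in $B\times\mathbb R$ horizontal at infinity. Then $\mathrm{CH}_0(B)=Z_0(B)/R_0(B)$, and $\mathrm{CH}_0(B)_{\hom}\subset \mathrm{CH}_0(B)$ is the subgroup of classes of degree zero (classes of $\sum n_ip_i$ with $\sum n_i=0$). *)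

(* Defs.v *)
From HB Require Import structures.
From mathcomp Require Import all_boot all_order all_algebra.
From mathcomp Require Import all_classical all_reals all_analysis.
From mathcomp Require Import freeg.

Set Implicit Arguments.
Unset Strict Implicit.
Unset Printing Implicit Defensive.

Import Order.TTheory GRing.Theory Num.Theory.
Import numFieldNormedType.Exports.

Local Open Scope classical_set_scope.
Local Open Scope ring_scope.

(* Only the values of [cmap] on [cdom] are meaningful. *)
Record chart (R : realType) (M : Type) (n : nat) := Chart {
  cdom : set M;
  cmap :> M -> 'cV[R]_n }.

Record is_chart (R : realType) (M : topologicalType) (n : nat)
    (c : chart R M n) : Prop := IsChart {
  cdom_open : open (cdom c);
  cmap_inj : set_inj (cdom c) c;
  cmap_cont : {within cdom c, continuous c};
  cmap_open : forall U, open U -> U `<=` cdom c -> open (c @` U) }.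

(* Near x one has d = A c + x0. *)
Definition affine_change (R : realType) (M : topologicalType) (n : nat)
    (c d : chart R M n) (x : M) (A : 'M[int]_n) (x0 : 'cV[R]_n) : Prop :=
  \forall y \near x, d y = map_mx intr A *m c y + x0.

(* [unitmx] over [int] is GL(n, Z).  A transition map lies in the pseudogroup
   of integral affine maps, i.e. it is the restriction of an element of
   R^n >| GL(n, Z) near every point; on a disconnected overlap of two charts
   the element may depend on the component. *)
Record ia_manifold (R : realType) (n : nat) := IaManifold {
  ia_space :> topologicalType;
  ia_atlas : set (chart R ia_space n);
  ia_hausdorff : hausdorff_space ia_space;
  ia_second_countable : @second_countable ia_space;
  ia_chart : forall c, ia_atlas c -> is_chart c;
  ia_cover : forall x, exists2 c, ia_atlas c & cdom c x;
  ia_transition : forall c d x,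
    ia_atlas c -> ia_atlas d -> cdom c x -> cdom d x ->
    exists A x0, A \in unitmx /\ affine_change c d x A x0 }.

Definition multilinear (n p : nat) (f : ('I_p -> 'cV[int]_n) -> int) : Prop :=
  forall (V : 'I_p -> 'cV[int]_n) (i : 'I_p),
    scalar (fun v : 'cV[int]_n => f (dfwith V i v)).

Definition alternating (n p : nat) (f : ('I_p -> 'cV[int]_n) -> int) : Prop :=
  forall (V : 'I_p -> 'cV[int]_n) (i j : 'I_p), i != j -> V i = V j -> f V = 0.

(* The fibre at b of the p-th exterior power of the cotangent lattice is the
   group of alternating p-linear integer forms on the lattice T_{Z,b} B.  A
   chart c at b identifies T_{Z,b} B with Z^n, and [tf c b] is the form read in
   this identification; it is meaningful for c in the atlas and b in its domain
   only. *)
Record tropical_form (R : realType) (n : nat) (B : ia_manifold R n) (p : nat) :=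
    TropicalForm {
  tf :> chart R B n -> B -> ('I_p -> 'cV[int]_n) -> int;
  tf_multilinear : forall c b, ia_atlas c -> cdom c b -> multilinear (tf c b);
  tf_alternating : forall c b, ia_atlas c -> cdom c b -> alternating (tf c b);
  tf_transition : forall c d b A x0,
    ia_atlas c -> ia_atlas d -> cdom c b -> cdom d b ->
    A \in unitmx -> affine_change c d b A x0 ->
    forall V, tf c b V = tf d b (fun i => A *m V i);
  tf_locally_constant : forall c b, ia_atlas c -> cdom c b ->
    \forall y \near b, tf c y = tf c b }.

Definition tf_nonzero (R : realType) (n : nat) (B : ia_manifold R n) (p : nat)
    (w : tropical_form B p) : Prop :=
  exists c b V, [/\ ia_atlas c, cdom c b & w c b V != 0].

(* A graph with edges e modelled on [0, l] or [0, +oo[ via [gpar e]; [glen e]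
   is l or +oo.  Loops and multiple edges are allowed. *)
Record metric_graph (R : realType) := MetricGraph {
  gspace :> topologicalType;
  gvert : set gspace;
  gedge : finType;
  glen : gedge -> \bar R;
  gpar : gedge -> R -> gspace }.

Section MetricGraph.
Variables (R : realType) (G : metric_graph R).
Implicit Types (e : gedge G) (x : G).

Definition edge_dom e : set R := [set t | 0 <= t /\ (t%:E <= glen e)%E].
Definition edge_int e : set R := [set t | 0 < t /\ (t%:E < glen e)%E].

Definition starts_at x e : bool := gpar e 0 == x.
Definition ends_at x e : bool :=
  (glen e \is a fin_num) && (gpar e (fine (glen e)) == x).

Definition valence x : nat := #|starts_at x| + #|ends_at x|.

Record is_tropical_curve : Prop := IsTropicalCurve {
  gvert_finite : finite_set (@gvert _ G);
  glen_gt0 : forall e, (0 < glen e)%E;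
  gpar_start : forall e, gvert (gpar e 0);
  gpar_end : forall e, glen e \is a fin_num -> gvert (gpar e (fine (glen e)));
  gpar_int : forall e t, edge_int e t -> ~ gvert (gpar e t);
  gpar_inj : forall e e' t t', edge_int e t -> edge_int e' t' ->
    gpar e t = gpar e' t' -> e = e' /\ t = t';
  gpar_cover : forall x, gvert x \/ exists e t, edge_int e t /\ gpar e t = x;
  (* G carries the quotient topology from the disjoint union of its vertices
     and its closed edges *)
  g_open : forall A : set G, open A <->
    forall e, exists2 U : set R, open U &
      gpar e @^-1` A `&` edge_dom e = U `&` edge_dom e;
  gvalence : forall x, gvert x -> valence x != 1%N }.

End MetricGraph.

Definition embedding (S T : topologicalType) (f : S -> T) : Prop :=
  injective f /\
  forall A : set S, open A <-> exists2 U : set T, open U & A = f @^-1` U.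

Definition proper_map (S T : topologicalType) (f : S -> T) : Prop :=
  continuous f /\ forall K : set T, compact K -> compact (f @^-1` K).

Definition primitive (n : nat) (u : 'cV[int]_n) : Prop :=
  forall (k : int) (v : 'cV[int]_n), u = k *: v -> k \is a GRing.unit.

Section ParametrizedCurve.
Variables (R : realType) (n : nat) (M : ia_manifold R n).
Variables (G : metric_graph R) (h : G -> M).
Implicit Types (e : gedge G) (c : chart R M n) (t : R).

(* In the chart c, h is affine near the point t of the edge e, with integral
   linear part v; at an end point of the edge this is a one-sided condition. *)
Definition has_slope e c t (v : 'cV[int]_n) : Prop :=
  \forall s \near within (edge_dom e) (nbhs t),
    c (h (gpar e s)) = c (h (gpar e t)) + (s - t) *: map_mx intr v.

(* The coordinates in c of dh(d/dt); [has_slope] determines v uniquely. *)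
Definition slope e c t : 'cV[int]_n := xget 0 (has_slope e c t).

(* The primitive integral vector pointing outwards from a vertex is d/dt at the
   start of an edge and -d/dt at its end; a loop contributes both. *)
Definition balanced (x : G) : Prop :=
  forall c, ia_atlas c -> cdom c (h x) ->
    \sum_(e | starts_at x e) slope e c 0
    + \sum_(e | ends_at x e) - slope e c (fine (glen e)) = 0.

Record is_parametrized_curve : Prop := IsParametrizedCurve {
  pc_curve : is_tropical_curve G;
  pc_embedding : embedding h;
  pc_proper : proper_map h;
  pc_affine : forall e t c,
    edge_dom e t -> ia_atlas c -> cdom c (h (gpar e t)) ->
    exists v, has_slope e c t v;
  pc_balanced : forall x, gvert x -> balanced x }.

Definition is_weight e (w : nat) : Prop :=
  (0 < w)%N /\
  forall t c, edge_dom e t -> ia_atlas c -> cdom c (h (gpar e t)) ->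
    exists2 u, primitive u & slope e c t = u *+ w.

End ParametrizedCurve.

Section Cylinder.
Variables (R : realType) (n : nat) (B : ia_manifold R n).

Definition cyl_chart (c : chart R B n) : chart R (B * R)%type (n + 1) :=
  Chart (cdom c `*` setT) (fun x => col_mx (c x.1) (const_mx x.2)).

Definition cyl_atlas : set (chart R (B * R)%type (n + 1)) :=
  cyl_chart @` @ia_atlas R n B.

Lemma cyl_hausdorff : hausdorff_space (B * R)%type.
Proof.
rewrite open_hausdorff => -[x s] [y t]; rewrite xpair_eqE negb_and.
case/orP=> [xy|st].
- have := @ia_hausdorff _ _ B; rewrite open_hausdorff => /(_ _ _ xy).
  move=> [[U V]] /= [/set_mem Ux /set_mem Vy] [oU oV /eqP UV0].
  exists (fst @^-1` U, fst @^-1` V); first by split; apply/mem_set.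
  split => /=; [exact: open_comp (fun z _ => cvg_fst) oU
               |exact: open_comp (fun z _ => cvg_fst) oV|].
  by rewrite -preimage_setI UV0 preimage_set0.
- have := @Rhausdorff R; rewrite open_hausdorff => /(_ _ _ st).
  move=> [[U V]] /= [/set_mem Ux /set_mem Vy] [oU oV /eqP UV0].
  exists (snd @^-1` U, snd @^-1` V); first by split; apply/mem_set.
  split => /=; [exact: open_comp (fun z _ => cvg_snd) oU
               |exact: open_comp (fun z _ => cvg_snd) oV|].
  by rewrite -preimage_setI UV0 preimage_set0.
Qed.

Lemma cyl_second_countable : @second_countable (B * R)%type.
Proof.
have [P cP [oP bP]] := @ia_second_countable _ _ B.
pose I (q : rat * rat) := [set` `](ratr q.1 : R), ratr q.2[].
exists [set D.1 `*` I D.2 | D in P `*` setT].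
  by apply: card_le_trans (card_image_le _ _) _; apply: countableX.
split=> [_ [[D q] [/= PD _] <-]|[x t] W [[U V] [/= Ux Vt] UVW]].
  have -> : D `*` I q = fst @^-1` D `&` snd @^-1` I q by [].
  apply: openI.
  - exact: open_comp (fun z _ => cvg_fst) (oP _ PD).
  - exact: open_comp (fun z _ => cvg_snd) (@interval_open _ _ _ _ _).
have [D [PD Dx] DU] := bP x _ Ux.
have [e /= e0 eV] := Vt.
have [q /itvP qt] : exists q : rat, ratr q \in `]t - e, t[ by
  apply: rat_in_itvoo; rewrite ltrBlDr ltrDl.
have [r /itvP rt] : exists r : rat, ratr r \in `]t, t + e[ by
  apply: rat_in_itvoo; rewrite ltrDl.
exists (D `*` I (q, r)).
  split; first by exists (D, (q, r)).
  by split => //=; rewrite /I /= in_itv /= qt rt.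
move=> [y s] [/= Dy]; rewrite /I /= in_itv /= => /andP[qs sr].
apply: UVW; split; [exact: DU|apply: eV => /=].
rewrite distrC ltr_distl (lt_trans _ qs) ?qt//= (lt_trans sr) ?rt//.
Qed.

Lemma cyl_is_chart d : cyl_atlas d -> is_chart d.
Proof.
case=> c Bc <-; have [oc ic cc opc] := ia_chart Bc.
split=> /=.
- have -> : cdom c `*` setT = fst @^-1` cdom c :> set (B * R)%type.
    by apply/seteqP; split=> -[x t] //= [].
  by apply: open_comp oc => z _; exact: cvg_fst.
- move=> [x s] [y t] /set_mem[/= cx _] /set_mem[/= cy _] /eq_col_mx[xy st].
  congr (_, _); first by apply: ic => //; exact/mem_set.
  by move/matrixP: st => /(_ 0 0); rewrite !mxE.
- apply: continuous_in_subspaceT => -[x t] /set_mem[/= cx _].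
  have {}cc : {for x, continuous c}.
    by move: cc; rewrite continuous_open_subspace// => /(_ x); apply; exact/mem_set.
  move=> A [P nP PA]; rewrite nbhs_filterE.
  have {nP}: \forall y \near (x, t), forall i j,
      P i j (col_mx (c y.1) (const_mx y.2) i j).
    have nF : Filter (nbhs (x, t)) by exact: nbhs_filter.
    apply: (@filter_forall _ _ _ _ nF) => i.
    apply: (@filter_forall _ _ _ _ nF) => j.
    have := nP i j; case: (split_ordP i) => k -> /=.
      rewrite col_mxEu => nPk.
      have xc : c z.1 k j @[z --> (x, t)] --> c x k j.
        apply: (@cvg_comp _ _ _ fst (fun z => c z k j) _ (nbhs x)).
          exact: cvg_fst.
        by move=> D /(@coord_continuous _ _ _ k j (c x)); exact: cc.
      by apply: (@filterS _ _ nF) (xc _ nPk) => z /=; rewrite col_mxEu.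
    rewrite col_mxEd mxE => nPk.
    apply: (@filterS _ _ nF) (@cvg_snd _ _ (nbhs x) (nbhs t) _ _ nPk) => z /=.
    by rewrite col_mxEd mxE.
  by apply: (@filterS _ _ (@nbhs_filter _ _)) => z Pz; exact: PA.
- move=> U oU Uc.
  rewrite openE => _ [[x t] Uxt <-].
  have [[V W] [/= Vx Wt] VWU] := open_nbhs_nbhs (conj oU Uxt).
  have Vc : V `<=` cdom c.
    by move=> y Vy; have [] := Uc (y, t) (VWU (y, t) (conj Vy (nbhs_singleton Wt))).
  have oc' : open (c @` V°).
    by apply: opc; [exact: open_interior|move=> y /interior_subset/Vc].
  have [P nP PcV] : nbhs (c x) (c @` V°).
    by apply: open_nbhs_nbhs; split => //; exists x.
  exists (fun i j => match fintype.split i with inl k => P k j | inr _ => W end).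
    move=> i j; rewrite mxE; case: (fintype.split i) => k /=; first exact: nP.
    by rewrite mxE.
  move=> N PN.
  have [k j|y Vy cy] := PcV (usubmx N).
    by have := PN (lshift 1 k) j; rewrite (fintype.unsplitK (inl k)) mxE.
  exists (y, N (rshift n 0) 0).
    apply: VWU; split => /=; first exact: interior_subset.
    by have := PN (rshift n 0) 0; rewrite (fintype.unsplitK (inr 0)).
  rewrite /= cy -[RHS]vsubmxK; congr col_mx.
  by apply/matrixP => i j; rewrite !mxE !ord1.
Qed.

Lemma cyl_cover x : exists2 d, cyl_atlas d & cdom d x.
Proof.
by have [c Bc cx] := ia_cover x.1; exists (cyl_chart c); [exists c|split].
Qed.

Lemma cyl_transition c d x :
  cyl_atlas c -> cyl_atlas d -> cdom c x -> cdom d x ->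
  exists A x0, A \in unitmx /\ affine_change c d x A x0.
Proof.
move=> [c' Bc <-] [d' Bd <-] [/= cx _] [dx _].
have [A [x0 [uA cd]]] := ia_transition Bc Bd cx dx.
exists (block_mx A 0 0 1%:M), (col_mx x0 0); split.
  by rewrite unitmxE det_ublock det1 mulr1 -unitmxE.
rewrite /affine_change; move: cd; rewrite /affine_change => cd.
have : \forall z \near x, d' z.1 = map_mx intr A *m c' z.1 + x0 by exact: cvg_fst cd.
apply: filterS => -[y t] /= ->.
rewrite map_block_mx !raddf0 map_scalar_mx mul_block_col !mul0mx addr0 add0r.
by rewrite rmorph1 mul1mx add_col_mx addr0.
Qed.

Definition cylinder : ia_manifold R (n + 1) :=
  IaManifold cyl_hausdorff cyl_second_countable cyl_is_chart cyl_cover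
    cyl_transition.

End Cylinder.

Section ChowGroup.
Variables (R : realType) (n : nat) (B : ia_manifold R n).

Local Notation Z0 := {freeg B}.

Section Ends.
Variables (G : metric_graph R) (h : G -> cylinder B).

Definition horizontal_at_infinity : Prop :=
  forall e, glen e = +oo%E ->
    forall t, 0 <= t -> (h (gpar e t)).1 = (h (gpar e 0)).1.

Definition up_end (e : gedge G) : Prop :=
  glen e = +oo%E /\ (h (gpar e t)).2 @[t --> +oo] --> +oo.

Definition down_end (e : gedge G) : Prop :=
  glen e = +oo%E /\ (h (gpar e t)).2 @[t --> +oo] --> -oo.

Definition end_cycle (w : gedge G -> nat) : Z0 :=
  \sum_(e | `[< up_end e >]) << (h (gpar e 0)).1 >> *+ w e
  - \sum_(e | `[< down_end e >]) << (h (gpar e 0)).1 >> *+ w e.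

End Ends.

Definition R0_gen : set Z0 := [set z |
  exists (G : metric_graph R) (h : G -> cylinder B) (w : gedge G -> nat),
    [/\ is_parametrized_curve h, horizontal_at_infinity h,
        forall e, is_weight h e (w e) & z = end_cycle h w]].

Definition R0 : set Z0 :=
  smallest (fun S : set Z0 => zmod_closed (mem S)) R0_gen.

Definition R0_pred : {pred Z0} := mem R0.

Lemma R0_pred_closed : zmod_closed R0_pred.
Proof.
split=> [|x y]; rewrite /R0_pred; first by apply/mem_set => S [[/set_mem]].
move=> /set_mem Rx /set_mem Ry; apply/mem_set => S [[S0 SB] gS].
by apply/set_mem/SB; apply/mem_set; [exact: Rx|exact: Ry].
Qed.

HB.instance Definition _ := GRing.isZmodClosed.Build Z0 R0_pred R0_pred_closed.

Definition CH0 : zmodType := {ideal_quot R0_pred}.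

Definition ch0 (z : Z0) : CH0 := (\pi_{ideal_quot R0_pred} z)%qT.

Definition CH0_hom : set CH0 := ch0 @` [set z : Z0 | deg z = 0].

Definition diff_map (k : nat) (b : ('I_k -> B) * ('I_k -> B)) : CH0 :=
  \sum_(i < k) (ch0 << b.1 i >> - ch0 << b.2 i >>).

Lemma ch0_is_additive : zmod_morphism ch0.
Proof. exact: (raddfB \pi_{ideal_quot R0_pred}%qT). Qed.

HB.instance Definition _ :=
  GRing.isZmodMorphism.Build Z0 CH0 ch0 ch0_is_additive.

Lemma diff_map_hom k : set_fun [set: ('I_k -> B) * ('I_k -> B)] CH0_hom
  (@diff_map k).
Proof.
move=> b _; exists (\sum_(i < k) (<< b.1 i >> - << b.2 i >>)).
  by rewrite /= raddf_sum big1 // => i _; rewrite raddfB /= !degU subrr.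
by rewrite raddf_sum; apply: eq_bigr => i _; rewrite raddfB.
Qed.

End ChowGroup.

Arguments CH0_hom {R n} B.
Arguments diff_map {R n} B k b.

(* Main.v *)
Require Import Defs.
From HB Require Import structures.
From mathcomp Require Import all_boot all_order all_algebra.
From mathcomp Require Import all_classical all_reals all_analysis.
From mathcomp Require Import freeg.
From mathcomp Require Import ring lra.

(* A tropical form [w] can be evaluated at a single point.  For additive maps
   [phi_1, ..., phi_p : R -> rat], apply [phi_i] to the coordinates of [b] in a
   chart to get [p] rational vectors, and evaluate [w] on them.  If the [phi_i]
   kill the (countably many) translation parts of the transition maps of a
   countable atlas, the resulting rational number does not depend on the chart,
   and it extends to a homomorphism on 0-cycles.

   This homomorphism kills [R0]: along an edge with slope [s], the contraction
   of [w /\ dt] with [s], evaluated in the same way at the points of the edge,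
   is constant, because moving by time [t] changes the i-th argument by
   [phi_i t] times [s].  By balancing, the sum of these constants over the edges
   at a vertex vanishes; summing over the vertices, the bounded edges cancel and
   the unbounded ones contribute the value of the cycle at infinity.

   Now take [N > 2 k n] points near [b] whose coordinates involve reals that are
   independent over the rationals modulo the translation parts and the
   coordinates of [b].  Given [2 k] other points, a rank count provides a
   [phi_1] killing all their coordinates but not those of some of the [N]
   points.  With [p >= 2], the other [phi_i] can be chosen to isolate this
   point: then the sum of the [N] points minus [N] times [b] has a nonzero
   value, while every cycle supported on the [2 k] points has value zero. *)

Set Implicit Arguments.
Unset Strict Implicit.
Unset Printing Implicit Defensive.

Import Order.TTheory GRing.Theory Num.Theory.
Import numFieldNormedType.Exports.

Local Open Scope classical_set_scope.
Local Open Scope ring_scope.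

(** * Multilinear forms *)

Section Dfwith.
Variables (I : eqType) (T : Type).
Implicit Types (V : I -> T) (i j : I).

Lemma dfwith_id V i : dfwith V i (V i) = V.
Proof. by apply/funext => j; case: dfwithP. Qed.

Lemma dfwith_dfwith V i u v : dfwith (dfwith V i u) i v = dfwith V i v.
Proof.
apply/funext => j; have [<-|ij] := eqVneq i j; first by rewrite !dfwithin.
by rewrite !dfwithout.
Qed.

Lemma dfwithC V i j u v : i != j ->
  dfwith (dfwith V i u) j v = dfwith (dfwith V j v) i u.
Proof.
move=> ij; apply/funext => l; have [<-|il] := eqVneq i l.
  by rewrite dfwithin dfwithout 1?eq_sym// dfwithin.
have [<-|jl] := eqVneq j l; first by rewrite dfwithin dfwithout// dfwithin.
by rewrite !dfwithout.
Qed.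

End Dfwith.

Section Mlin.
Variables (K : comNzRingType) (n p : nat).
Implicit Types (f : ('I_p -> 'cV[K]_n) -> K) (V : 'I_p -> 'cV[K]_n).

Definition mlin f := forall V i, scalar (fun v => f (dfwith V i v)).
Definition malt f := forall V i j, i != j -> V i = V j -> f V = 0.

Variables (f : ('I_p -> 'cV[K]_n) -> K) (fM : mlin f).

Lemma mlinD V i u v :
  f (dfwith V i (u + v)) = f (dfwith V i u) + f (dfwith V i v).
Proof. by have := fM V i 1 u v; rewrite scale1r mul1r. Qed.

Lemma mlin0 V i : f (dfwith V i 0) = 0.
Proof. by apply: (addrI (f (dfwith V i 0))); rewrite -mlinD !addr0. Qed.

Lemma mlinZ V i a v : f (dfwith V i (a *: v)) = a * f (dfwith V i v).
Proof. by have := fM V i a v 0; rewrite mlin0 !addr0. Qed.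

Lemma mlin_sum V i (J : Type) (r : seq J) (P : pred J) (F : J -> 'cV[K]_n) :
  f (dfwith V i (\sum_(j <- r | P j) F j)) =
  \sum_(j <- r | P j) f (dfwith V i (F j)).
Proof.
apply: (big_morph (fun v => f (dfwith V i v))); last exact: mlin0.
exact: mlinD.
Qed.

(** Induction on the number [m] of leading arguments that may be arbitrary. Expanding the last of
    these in the standard basis reduces to [m - 1], and for [m = 0] only tuples of basis vectors
    remain. *)
Lemma mlin_eq0 :
  (forall a : 'I_p -> 'I_n, f (fun i => delta_mx (a i) 0) = 0) ->
  forall V, f V = 0.
Proof.
move=> f0 V.
suff H m : (m <= p)%N -> forall V,
    (forall i : 'I_p, (m <= i)%N -> exists a, V i = delta_mx a 0) -> f V = 0.
  by apply: (H p) => // i; rewrite leqNgt ltn_ord.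
elim: m => [_ W WE|m IH mp W WE].
  have /fin_all_exists[a aE] i := WE i (leq0n _).
  by rewrite -(f0 a); congr f; apply/funext.
pose i0 := Ordinal mp.
rewrite -(dfwith_id W i0) [W i0]matrix_sum_delta mlin_sum big1 // => j _.
rewrite big_ord1 mlinZ IH ?mulr0 ?(ltnW mp)// => i mi.
have [<-|ii0] := eqVneq i0 i; first by exists j; rewrite dfwithin ord1.
rewrite dfwithout//; apply: WE; rewrite ltn_neqAle mi andbT.
by apply: contra ii0 => /eqP e; apply/eqP/val_inj.
Qed.

End Mlin.

(** * Rational extension of integral forms *)

Section Rational.
Variables (n p : nat).

(** The extension of [f] by scalars to the rationals. The formula uses only values on basis vectors,
    so it is multilinear for every [f]; it extends [f] when [f] is multilinear, by [ratext_int] with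
    [q = 1]. *)
Definition ratext (f : ('I_p -> 'cV[int]_n) -> int) (V : 'I_p -> 'cV[rat]_n) : rat :=
  \sum_(a : {ffun 'I_p -> 'I_n})
    (f (fun i => delta_mx (a i) 0))%:~R * \prod_i V i (a i) 0.

Lemma sub_mlin (K : comNzRingType) (f g : ('I_p -> 'cV[K]_n) -> K) :
  mlin f -> mlin g -> mlin (fun V => f V - g V).
Proof. by move=> fM gM V i a u v /=; rewrite fM gM; ring. Qed.

Lemma sum_prod_mlin (K : comNzRingType) (C : {ffun 'I_p -> 'I_n} -> K) :
  mlin (fun V => \sum_(a : {ffun 'I_p -> 'I_n}) C a * \prod_i V i (a i) 0).
Proof.
move=> V i k u v /=; rewrite mulr_sumr -big_split /=; apply: eq_bigr => a _.
have E w : \prod_j dfwith V i w j (a j) 0 =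
    w (a i) 0 * \prod_(j | j != i) V j (a j) 0.
  rewrite (bigD1 i) //= dfwithin; congr (_ * _).
  by apply: eq_bigr => j ji; rewrite dfwithout 1?eq_sym.
by rewrite !E !mxE; ring.
Qed.

Lemma prod_delta (K : comNzRingType) (a b : {ffun 'I_p -> 'I_n}) :
  \prod_i (delta_mx (b i) 0 : 'cV[K]_n) (a i) 0 = (a == b)%:R.
Proof.
have [->|ab] := eqVneq a b; first by rewrite big1 // => i _; rewrite mxE !eqxx.
have [i abi] : exists i, a i != b i.
  apply/existsP; apply: contraR ab; rewrite negb_exists => /forallP ab.
  by apply/eqP/ffunP => i; apply/eqP; rewrite -[_ == _]negbK.
by rewrite (bigD1 i) //= mxE (negbTE abi) mul0r.
Qed.

Variables (f : ('I_p -> 'cV[int]_n) -> int) (fM : mlin f).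

Lemma mlin_expand U :
  f U = \sum_(a : {ffun 'I_p -> 'I_n})
    f (fun i => delta_mx (a i) 0) * \prod_i U i (a i) 0.
Proof.
apply/eqP; rewrite -subr_eq0; apply/eqP; move: U; apply: mlin_eq0.
  by apply: sub_mlin fM _; exact: sum_prod_mlin.
move=> b; rewrite (bigD1 (finfun b)) //= [X in _ - (_ + X)]big1 ?addr0.
  have E i : delta_mx (b i) 0 = delta_mx (finfun b i) 0 :> 'cV[int]_n.
    by rewrite ffunE.
  under [\prod_i _]eq_bigr do rewrite E.
  rewrite prod_delta eqxx mulr1.
  have -> : (fun i => delta_mx (b i) 0) =
      (fun i => delta_mx (finfun b i) 0 : 'cV[int]_n) by exact/funext.
  by rewrite subrr.
move=> a ab; have E i : delta_mx (b i) 0 = delta_mx (finfun b i) 0 :> 'cV[int]_n.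
  by rewrite ffunE.
under [\prod_i _]eq_bigr do rewrite E.
by rewrite prod_delta (negbTE ab) mulr0.
Qed.

Lemma ratext_mlin : mlin (ratext f).
Proof. exact: sum_prod_mlin. Qed.

Lemma ratext_int q (U : 'I_p -> 'cV[int]_n) :
  ratext f (fun i => q *: map_mx intr (U i)) = q ^+ p * (f U)%:~R.
Proof.
rewrite mlin_expand rmorph_sum mulr_sumr; apply: eq_bigr => a _ /=.
under eq_bigr do rewrite !mxE.
by rewrite big_split /= prodr_const card_ord rmorphM rmorph_prod /=; ring.
Qed.

(** One scalar serves all [p] vectors, as [ratext_int] requires: the inverse of the product of all
    denominators. Identities between integral forms pass to their rational extensions in this
    way. *)
Lemma common_denominator (V : 'I_p -> 'cV[rat]_n) :
  exists q U, V = fun i => q *: map_mx intr (U i) :> 'cV[rat]_n.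
Proof.
pose d (x : 'I_p * 'I_n) := denq (V x.1 x.2 0).
exists (\prod_x d x)%:~R^-1.
exists (fun i => \col_j (numq (V i j 0) * \prod_(x | x != (i, j)) d x)).
apply/funext => i; apply/matrixP => j z; rewrite ord1 !mxE.
rewrite (bigD1 (i, j)) //= !rmorphM /=.
set P := (\prod_(_ | _) _)%:~R.
have P0 : P != 0 by rewrite intr_eq0; apply/prodf_neq0 => x _; exact: denq_neq0.
have D0 : (d (i, j))%:~R != 0 :> rat by rewrite intr_eq0 denq_neq0.
rewrite -[LHS]divq_num_den -/(d (i, j)).
by rewrite invfM; field; rewrite P0 D0.
Qed.

Lemma ratext_alt : malt f -> malt (ratext f).
Proof.
move=> fA V i j ij.
have [q [U ->]] := common_denominator V; rewrite ratext_int.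
(* The common scalar is not known to be nonzero. If it is zero, the factor [q ^+ p] vanishes, since
   the index [i] shows that [p] is positive. *)
have [->|q0] := eqVneq q 0.
  by rewrite expr0n (gtn_eqF (leq_ltn_trans (leq0n i) (ltn_ord i))) mul0r.
move=> /(scalerI q0) /matrixP UU'.
have UU : U i = U j.
  by apply/matrixP => a b; have := UU' a b; rewrite !mxE => /intr_inj.
by rewrite (fA _ _ _ ij UU) mulr0.
Qed.

End Rational.

Arguments ratext_int {n p f} fM q U.

Lemma ratext_mulmx (n p : nat) (f g : ('I_p -> 'cV[int]_n) -> int) (fM : mlin f)
    (gM : mlin g) (A : 'M[int]_n) (V : 'I_p -> 'cV[rat]_n) :
  (forall U, f U = g (fun i => A *m U i)) ->
  ratext f V = ratext g (fun i => map_mx intr A *m V i).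
Proof.
move=> fg; have [q [U ->]] := common_denominator V.
rewrite ratext_int// fg.
rewrite -(ratext_int gM); congr ratext; apply/funext => i.
by rewrite -scalemxAr map_mxM.
Qed.

Section Contraction.
Variables (n p : nat) (f : ('I_p -> 'cV[rat]_n) -> rat).
Hypotheses (fM : mlin f) (fA : malt f).
Implicit Types (s : 'cV[rat]_n) (r : rat) (X : 'I_p -> 'cV[rat]_n) (T : 'I_p -> rat).

(* The contraction of [f /\ dt] with the vector [(s, r)], evaluated at the
   vectors [(X i, T i)], up to sign. *)
Definition contr s r X T : rat := r * f X - \sum_i T i * f (dfwith X i s).

Lemma contrD s s' r r' X T :
  contr (s + s') (r + r') X T = contr s r X T + contr s' r' X T.
Proof.
rewrite /contr; under eq_bigr do rewrite mlinD// mulrDr.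
by rewrite big_split /=; ring.
Qed.

Lemma contr0 X T : contr 0 0 X T = 0.
Proof.
rewrite /contr mul0r big1 ?subr0// => i _.
by rewrite mlin0// mulr0.
Qed.

(** The first term and the [j]-th summand both grow by [q * r * f (dfwith X j s)], and these cancel.
    In any other summand the change has [s] in two slots and vanishes by alternation. *)
Lemma contr_flow1 s r X T j q :
  contr s r (dfwith X j (X j + q *: s)) (dfwith T j (T j + q * r)) =
  contr s r X T.
Proof.
rewrite /contr mlinD// mlinZ// dfwith_id.
rewrite (bigD1 j) //= [in RHS](bigD1 j) //= dfwithin dfwith_dfwith.
rewrite [X in _ - (_ + X) = _](eq_bigr (fun i => T i * f (dfwith X i s))).
  by ring.
move=> i ij; have ji : j != i by rewrite eq_sym.
rewrite dfwithout// dfwithC// mlinD// mlinZ//.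
rewrite (@fA (dfwith _ j s) i j) ?mulr0 ?addr0//.
  by rewrite dfwithC// dfwith_id.
by rewrite dfwithin dfwithout 1?eq_sym// dfwithin.
Qed.

Lemma contr_flow s r X T q :
  contr s r (fun i => X i + q i *: s) (fun i => T i + q i * r) = contr s r X T.
Proof.
(* The arguments are moved one at a time: [q' m] moves only the first [m] of them. *)
pose q' m (i : 'I_p) := if (i < m)%N then q i else 0.
suff H m : (m <= p)%N ->
    contr s r (fun i => X i + q' m i *: s) (fun i => T i + q' m i * r) =
    contr s r X T.
  rewrite -[RHS](H p)//; congr contr; apply/funext => i;
    by rewrite /q' ltn_ord.
elim: m => [_|m IH mp].
  by congr contr; apply/funext => i; rewrite /q' ltn0 ?scale0r ?mul0r addr0.
rewrite -(IH (ltnW mp)).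
rewrite -[RHS](contr_flow1 s r _ _ (Ordinal mp) (q (Ordinal mp))).
have q'm : q' m (Ordinal mp) = 0 by rewrite /q' /= ltnn.
congr contr; apply/funext => i; have [<-|im] := eqVneq (Ordinal mp) i.
- by rewrite dfwithin q'm scale0r addr0 /q' /= leqnn.
- rewrite dfwithout// /q' ltnS leq_eqVlt; case: eqVneq => //= e.
  by case/eqP: im; apply/val_inj.
- by rewrite dfwithin q'm mul0r addr0 /q' /= leqnn.
- rewrite dfwithout// /q' ltnS leq_eqVlt; case: eqVneq => //= e.
  by case/eqP: im; apply/val_inj.
Qed.

End Contraction.

(** * Rational subspaces of the reals *)

Section RationalSubspaces.
Variable R : realType.
Implicit Types (M : set R) (x y : R).

Definition qclosed M :=
  M 0 /\ forall (q : rat) x y, M x -> M y -> M (ratr q * x + y).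

Lemma qclosedZ M q x : qclosed M -> M x -> M (ratr q * x).
Proof. by move=> [M0 MD] Mx; rewrite -[_ * _]addr0; apply: MD. Qed.

Lemma qclosed_sum M (J : Type) (r : seq J) (P : pred J) (q : J -> rat) (F : J -> R) :
  qclosed M -> (forall j, P j -> M (F j)) ->
  M (\sum_(j <- r | P j) ratr (q j) * F j).
Proof.
move=> [M0 MD] MF; elim/big_rec : _ => // j x Pj Mx.
by apply: MD => //; exact: MF.
Qed.

(** Zorn's lemma gives a maximal rational subspace [L] containing [M] but not [y]. It is a
    complement of the line through [y], and [phi] is the coordinate along [y]. *)
Lemma qclosed_functional M y : qclosed M -> ~ M y ->
  exists phi : R -> rat,
    [/\ {morph phi : a b / a + b}, forall x, M x -> phi x = 0 & phi y = 1].
Proof.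
move=> Mc My.
(* Taking the union with [M] makes the empty chain admissible: its union is empty and yields [M]
   itself. *)
pose P X := qclosed (M `|` X) /\ ~ (M `|` X) y.
have [F FP Ftot|N [[Nc Ny] Nmax]] := @Zorn_bigcup _ P.
  split; last first.
    case=> // -[X FX Xy]; have [_] := FP X FX; apply.
    by right.
  split; first by left; case: Mc.
  have H X a b : F X -> (M `|` X) a -> (M `|` X) b ->
      forall q, (M `|` \bigcup_(Z in F) Z) (ratr q * a + b).
    move=> FX Xa Xb q; have [[_ XD] _] := FP X FX.
    by have [Mz|Xz] := XD q _ _ Xa Xb; [left|right; exists X].
  move=> q a b [Ma|[X FX Xa]] [Mb|[Z FZ Zb]].
  - by left; case: Mc => _ MD; exact: MD.
  - exact: H FZ (or_introl Ma) (or_intror Zb) q.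
  - exact: H FX (or_intror Xa) (or_introl Mb) q.
  - have [XZ|ZX] := Ftot X Z FX FZ.
      exact: H FZ (or_intror (XZ _ Xa)) (or_intror Zb) q.
    exact: H FX (or_intror Xa) (or_intror (ZX _ Zb)) q.
pose L : set R := M `|` N; rewrite -/L in Nc Ny.
have ML x : M x -> L x by left.
have ex x : exists q, L (x - ratr q * y).
  apply: contrapT => nex.
  have nLx : ~ L x by move=> Lx; apply: nex; exists 0; rewrite raddf0 mul0r subr0.
  (* The span of [L] and [x] is strictly larger than [L], so by maximality it contains [y]. The
     coefficient of [x] in [y] is nonzero, and dividing by it expresses [x] modulo [L] as a multiple
     of [y]. *)
  pose X := [set z | exists q a, L a /\ z = ratr q * x + a].
  have LX : L `<=` X by move=> a La; exists 0, a; rewrite raddf0 mul0r add0r.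
  have Xx : X x by exists 1, 0; rewrite rmorph1 mul1r addr0; split=> //; case: Nc.
  apply: (Nmax X).
    split; first by move=> z Nz; apply: LX; right.
    by move=> XN; apply: nLx; right; exact: XN.
  have MX : M `|` X = X by apply/setUidPr => z Mz; exact/LX/ML.
  split; rewrite MX.
    split; first by apply: LX; case: Nc.
    move=> q _ _ [q1 [a1 [La1 ->]]] [q2 [a2 [La2 ->]]].
    exists (q * q1 + q2), (ratr q * a1 + a2).
    split; first by case: Nc => _ LD; exact: LD.
    by rewrite rmorphD rmorphM /=; ring.
  move=> [q [a [La ya]]].
  have [q0|q0] := eqVneq q 0.
    by apply: Ny; rewrite ya q0 raddf0 mul0r add0r.
  apply: nex; exists q^-1.
  have -> : x - ratr q^-1 * y = ratr (- q^-1) * a.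
    rewrite ya rmorphN /= fmorphV; field.
    by rewrite fmorph_eq0.
  exact: qclosedZ.
(* Two distinct coefficients would put a nonzero multiple of [y] in [L]. *)
have uniq x q q' : L (x - ratr q * y) -> L (x - ratr q' * y) -> q = q'.
  move=> Lq Lq'; apply/eqP; rewrite -subr_eq0; apply/negPn/negP => d0; apply: Ny.
  have -> : y = ratr (q - q')^-1 *
      (ratr (-1) * (x - ratr q * y) + (x - ratr q' * y)).
    rewrite rmorphN rmorph1 fmorphV rmorphB /=; field.
    by rewrite -rmorphB fmorph_eq0.
  by apply: qclosedZ => //; case: Nc => _ LD; exact: LD.
exists (fun x => xget 0 [set q | L (x - ratr q * y)]).
have phiP x : L (x - ratr (xget 0 [set q | L (x - ratr q * y)]) * y).
  by case: xgetP => [q _ //|nq]; have [q /nq] := ex x.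
split=> [a b|x Mx|].
- apply: uniq (phiP _) _; rewrite rmorphD /=.
  have -> : forall u v, a + b - (u + v) * y =
      ratr 1 * (a - u * y) + (b - v * y) by move=> u v; rewrite rmorph1; ring.
  by case: Nc => _ LD; apply: LD; apply: phiP.
- by apply: uniq (phiP _) _; rewrite raddf0 mul0r subr0; exact: ML.
- by apply: uniq (phiP _) _; rewrite rmorph1 mul1r subrr; case: Nc.
Qed.

Definition qspan (T : Type) (u : T -> R) : set R :=
  [set x | exists s : seq (rat * T), x = \sum_(a <- s) ratr a.1 * u a.2].

Lemma qspan_closed T (u : T -> R) : qclosed (qspan u).
Proof.
split; first by exists [::]; rewrite big_nil.
move=> q _ _ [s ->] [s' ->]; exists ([seq (q * a.1, a.2) | a <- s] ++ s').
rewrite big_cat big_map mulr_sumr; congr (_ + _); apply: eq_bigr => a _ /=.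
by rewrite rmorphM /= mulrA.
Qed.

Lemma qspan_gen T (u : T -> R) t : qspan u (u t).
Proof. by exists [:: (1, t)]; rewrite big_seq1 rmorph1 mul1r. Qed.

Lemma qspan_countable (T : countType) (u : T -> R) : countable (qspan u).
Proof.
have -> : qspan u =
    (fun s : seq (rat * T) => \sum_(a <- s) ratr a.1 * u a.2) @` setT.
  by apply/seteqP; split=> [x [s ->]|_ [s _ <-]]; exists s.
exact: card_le_trans (card_image_le _ _) (countableP _).
Qed.

Definition qadd M (C : finType) (c : C -> R) : set R :=
  [set x | exists q : {ffun C -> rat}, M (x - \sum_j ratr (q j) * c j)].

Lemma qadd_closed M (C : finType) (c : C -> R) : qclosed M -> qclosed (qadd M c).
Proof.
move=> [M0 MD]; split.
  exists [ffun=> 0]; rewrite big1 ?subr0// => j _.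
  by rewrite ffunE raddf0 mul0r.
move=> q x y [v Mv] [w Mw]; exists [ffun j => q * v j + w j].
have -> : \sum_j ratr ([ffun j => q * v j + w j] j) * c j =
    ratr q * (\sum_j ratr (v j) * c j) + \sum_j ratr (w j) * c j.
  rewrite mulr_sumr -big_split /=; apply: eq_bigr => j _.
  by rewrite ffunE rmorphD rmorphM /=; ring.
have -> : forall a b, ratr q * x + y - (ratr q * a + b) =
  ratr q * (x - a) + (y - b) by move=> a b; ring.
exact: MD.
Qed.

Lemma qadd_sub M (C : finType) (c : C -> R) : M `<=` qadd M c.
Proof.
move=> x Mx; exists [ffun=> 0]; rewrite big1 ?subr0// => j _.
by rewrite ffunE raddf0 mul0r.
Qed.

Lemma qadd_gen M (C : finType) (c : C -> R) j : qclosed M -> qadd M c (c j).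
Proof.
move=> [M0 _]; exists [ffun i => (i == j)%:R].
rewrite (bigD1 j) //= ffunE eqxx rmorph1 mul1r big1 ?addr0 ?subrr//.
by move=> i /negbTE ij; rewrite ffunE ij raddf0 mul0r.
Qed.

Lemma qadd_countable M (C : finType) (c : C -> R) :
  countable M -> countable (qadd M c).
Proof.
move=> cM; have -> : qadd M c = (fun z : R * {ffun C -> rat} =>
    z.1 + \sum_j ratr (z.2 j) * c j) @` (M `*` setT).
  apply/seteqP; split=> [x [q Mq]|_ [[x q] [/= Mx _] <-]].
    by exists (x - \sum_j ratr (q j) * c j, q) => //=; rewrite subrK.
  by exists q; rewrite addrK.
apply: card_le_trans (card_image_le _ _) _; exact: countableX.
Qed.

(** For a rational subspace [M]: linear independence over the rationals of the images of [y] in the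
    quotient of the reals by [M]. *)
Definition qindep M (J : finType) (y : J -> R) :=
  forall v : J -> rat, M (\sum_j ratr (v j) * y j) -> forall j, v j = 0.

Lemma qindep_inj M (J J' : finType) (f : J' -> J) (y : J -> R) :
  injective f -> qindep M y -> qindep M (y \o f).
Proof.
move=> fi yM v Mv j.
(* The coefficients [v], transported along [f] and extended by zero outside its image. *)
pose w i := \sum_(j' | f j' == i) v j'.
have wf j' : w (f j') = v j'.
  rewrite /w (bigD1 j') //= big1 ?addr0// => i /andP[/eqP/fi ->].
  by rewrite eqxx.
rewrite -wf; apply: yM.
rewrite (_ : \sum_i _ = \sum_j ratr (v j) * y (f j)) //.
rewrite (partition_big f xpredT) //=; apply: eq_bigr => i _.
rewrite /w rmorph_sum mulr_suml /=; apply: eq_bigr => j' /eqP <- //.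
Qed.

(** The factor [(i != j)] replaces the [j]-th member by zero, which removes it from the family
    without changing the index type. *)
Lemma qindep_sub M (J : finType) (y : J -> R) j : qclosed M -> qindep M y ->
  ~ qadd M (fun i => y i *+ (i != j)) (y j).
Proof.
move=> Mc yM [q Mq].
suff : (fun i => if i == j then 1 else - q i) j = 0.
  by rewrite eqxx => /eqP; rewrite oner_eq0.
apply: (yM (fun i => if i == j then 1 else - q i)).
move: Mq; rewrite (bigD1 j) //= eqxx mulr0n mulr0 add0r.
rewrite [X in _ -> M X](bigD1 j) //= eqxx rmorph1 mul1r -sumrN.
rewrite (eq_bigr (fun i => ratr (if i == j then 1 else - q i) * y i)) //.
by move=> i /negbTE ij; rewrite ij rmorphN mulNr.
Qed.

(** Otherwise each [y j] is a combination of the [c i] modulo [M]. The coefficient matrix has more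
    rows than columns, and a nonzero vector of its left kernel is a relation among the [y j] modulo
    [M]. *)
Lemma qindep_exchange M (J C : finType) (y : J -> R) (c : C -> R) :
  qclosed M -> qindep M y -> (#|C| < #|J|)%N -> exists j, ~ qadd M c (y j).
Proof.
move=> Mc yM CJ; apply: contrapT => nex.
have {}nex j : exists q : {ffun C -> rat}, M (y j - \sum_i ratr (q i) * c i).
  by apply: contrapT => nj; apply: nex; exists j.
have [q qP] := fin_all_exists nex.
pose Q : 'M[rat]_(#|J|, #|C|) :=
  \matrix_(i, k) q (enum_val i) (enum_val k).
have /rowV0Pn[v vQ v0] : kermx Q != 0.
  rewrite kermx_eq0 /row_free neq_ltn; apply/orP; left.
  exact: leq_ltn_trans (rank_leq_col _) CJ.
have {}vQ : v *m Q = 0 by exact/sub_kermxP.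
have v1 j : v 0 (enum_rank j) = 0.
  apply: (yM (fun j => v 0 (enum_rank j))).
  suff -> : \sum_j ratr (v 0 (enum_rank j)) * y j =
      \sum_j ratr (v 0 (enum_rank j)) * (y j - \sum_i ratr (q j i) * c i).
    by apply: qclosed_sum => // i _; exact: qP.
  under [RHS]eq_bigr do rewrite mulrBr.
  rewrite sumrB [X in _ - X](_ : _ = 0) ?subr0//.
  under eq_bigr do rewrite mulr_sumr.
  rewrite exchange_big big1 //= => i _.
  transitivity (ratr (\sum_j v 0 (enum_rank j) * q j i) * c i : R).
    rewrite rmorph_sum mulr_suml; apply: eq_bigr => k _.
    by rewrite rmorphM mulrA.
  have /matrixP/(_ 0 (enum_rank i)) := vQ; rewrite !mxE => vQi.
  rewrite [X in ratr X](_ : _ = 0) ?raddf0 ?mul0r// -[RHS]vQi.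
  rewrite [RHS](reindex enum_rank) /=.
    by apply: eq_bigr => k _; rewrite mxE !enum_rankK.
  exact/onW_bij/enum_rank_bij.
case/eqP: v0; apply/rowP => k; rewrite mxE -(enum_valK k) v1 //.
Qed.

Lemma itv_not_countable (e : R) : 0 < e -> ~ countable `]0, e[%classic.
Proof.
move=> e0 /countable_lebesgue_measure0.
rewrite lebesgue_measure_itv /= lte_fin e0 sube0 => /eqP.
by rewrite eqe (gt_eqF e0).
Qed.

(** The numbers are chosen successively: [M] together with the span of the earlier ones is
    countable, so it cannot contain the whole interval. *)
Lemma qindep_exists_ord M (e : R) L : qclosed M -> countable M -> 0 < e ->
  exists y : 'I_L -> R, qindep M y /\ forall j, 0 < y j < e.
Proof.
move=> Mc cM e0; elim: L => [|L [y [yM ye]]].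
  by exists (fun=> 0); split=> [v _ []//|[]//].
have [z ze nz] : exists2 z, 0 < z < e & ~ qadd M y z.
  apply: contrapT => nex; apply: (itv_not_countable e0).
  apply: sub_countable (qadd_countable y cM); apply: subset_card_le => z /=.
  by rewrite in_itv /= => ze; apply: contrapT => nz; apply: nex; exists z.
exists (fun i => oapp y z (unlift ord_max i)); split; last first.
  by move=> j; case: unliftP => [i|] _ //=.
have E i : widen_ord (leqnSn L) i = fintype.lift ord_max i.
  by apply/val_inj; rewrite /= /bump leqNgt ltn_ord.
move=> v; rewrite big_ord_recr /= unlift_none /=.
under eq_bigr do rewrite E liftK /=.
(* A relation with nonzero last coefficient could be solved for [z], which would then lie in
   [qadd M y]. *)
have [v0|v0] := eqVneq (v ord_max) 0.
  rewrite v0 raddf0 mul0r addr0 => /yM vl j.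
  by case: (unliftP ord_max j) => [i|] -> //; exact: vl.
move=> Mv; case: nz.
exists [ffun i => - (v ord_max)^-1 * v (fintype.lift ord_max i)].
have -> : \sum_j
    ratr ([ffun i => - (v ord_max)^-1 * v (fintype.lift ord_max i)] j) * y j =
    ratr (- (v ord_max)^-1) * \sum_(i < L) ratr (v (fintype.lift ord_max i)) * y i.
  by rewrite mulr_sumr; apply: eq_bigr => i _; rewrite ffunE rmorphM mulrA.
have V0 : ratr (v ord_max) != 0 :> R by rewrite fmorph_eq0.
rewrite (_ : z - _ = ratr (v ord_max)^-1 *
    (\sum_(i < L) ratr (v (fintype.lift ord_max i)) * y i + ratr (v ord_max) * z)).
  exact: qclosedZ.
by rewrite rmorphN /= fmorphV; field.
Qed.

Lemma qindep_exists M (e : R) (J : finType) : qclosed M -> countable M -> 0 < e ->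
  exists y : J -> R, qindep M y /\ forall j, 0 < y j < e.
Proof.
move=> Mc cM e0; have [y [yM ye]] := qindep_exists_ord #|J| Mc cM e0.
exists (y \o enum_rank); split=> [|j]; last exact: ye.
exact: qindep_inj enum_rank_inj yM.
Qed.

End RationalSubspaces.

(** * Tropical curves *)

Section MapAdditive.
Variables (R : realType) (phi : {additive R -> rat}).

Lemma additive_mulrint a (z : int) : phi (a * z%:~R) = phi a * z%:~R.
Proof. by rewrite !mulrzr raddfMz. Qed.

Lemma map_mx_intmul m n (A : 'M[int]_(m, n)) (v : 'cV[R]_n) :
  map_mx phi (map_mx intr A *m v) = map_mx intr A *m map_mx phi v.
Proof.
apply/matrixP => i j; rewrite !mxE raddf_sum; apply: eq_bigr => k _ /=.
by rewrite !mxE mulrC additive_mulrint mulrC.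
Qed.

Lemma map_mx_scaleint m a (s : 'cV[int]_m) :
  map_mx phi (a *: map_mx intr s) = phi a *: map_mx intr s.
Proof. by apply/matrixP => i j; rewrite !mxE additive_mulrint. Qed.

End MapAdditive.

Section Edges.
Variables (R : realType) (G : metric_graph R).
Hypothesis GP : is_tropical_curve G.
Implicit Types e : gedge G.

Lemma edge_dom0 e : edge_dom e 0.
Proof. by split=> //; exact/ltW/glen_gt0. Qed.

Lemma edge_dom_end e : glen e \is a fin_num -> edge_dom e (fine (glen e)).
Proof.
move=> fe; split; last by rewrite fineK.
by apply: fine_ge0; exact/ltW/glen_gt0.
Qed.

Lemma edge_dom_infty e t : glen e = +oo%E -> 0 <= t -> edge_dom e t.
Proof. by move=> ge t0; split=> //; rewrite ge leey. Qed.

Lemma glen_infty e : glen e \isn't a fin_num -> glen e = +oo%E.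
Proof.
have := glen_gt0 GP e; case: (glen e) => //.
Qed.

Lemma edge_dom_interval e : is_interval (edge_dom e).
Proof.
move=> x y [x0 _] [_ yl] z /andP[xz zy]; split; first exact: le_trans xz.
by apply: le_trans yl; rewrite lee_fin.
Qed.

(** The parameter interval is connected, and the set where [f] takes the value [f 0] is relatively
    open and closed in it. *)
Lemma edge_locally_constant (T : Type) (f : R -> T) e :
  (forall t, edge_dom e t ->
     \forall s \near within (edge_dom e) (nbhs t), f s = f t) ->
  forall t, edge_dom e t -> f t = f 0.
Proof.
move=> floc.
have /connected_intervalP conn := @edge_dom_interval e.
pose A := [set t | edge_dom e t /\ f t = f 0].
suff AE : A = edge_dom e by move=> t; rewrite -AE => -[].
apply: conn.
- by exists 0; split; first exact: edge_dom0.
- exists (interior [set t | edge_dom e t -> f t = f 0]); first exact: open_interior.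
  apply/seteqP; split=> t [et].
    by move=> ft; split=> //; rewrite /interior -ft; exact: floc.
  by move=> /interior_subset ft; split=> //; exact: ft.
- exists (~` interior [set t | edge_dom e t -> f t <> f 0]).
    by apply: open_closedC; exact: open_interior.
  apply/seteqP; split=> t [et].
    by move=> ft; split=> // /interior_subset /(_ et).
  move=> nft; split=> //; apply: contrapT => ft; apply: nft.
  by apply: filterS (floc _ et) => s -> /ft.
Qed.

(** An edge has positive length, so [t] is not isolated in it: it is approached along the segment to
    another point [t']. This makes slopes unique, also at the ends of an edge. *)
Lemma edge_near_neq e t (P : set R) : edge_dom e t ->
  (\forall s \near within (edge_dom e) (nbhs t), P s) ->
  exists s, s != t /\ P s.
Proof.
move=> et Pt.
have [t' [et' tt']] : exists t', edge_dom e t' /\ t' != t.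
  have [t0|t0] := eqVneq t 0; last by exists 0; split; [exact: edge_dom0|rewrite eq_sym].
  have [fe|/glen_infty fe] := boolP (glen e \is a fin_num).
    exists (fine (glen e)); split; first exact: edge_dom_end.
    by rewrite t0 gt_eqF// fine_gt0// (glen_gt0 GP)//= ltey_eq fe.
  exists 1; split; first by apply: edge_dom_infty.
  by rewrite t0 oner_eq0.
have cv : t + l * (t' - t) @[l --> (0 : R)^'+] --> t.
  have : t + l * (t' - t) @[l --> (0 : R)^'+] --> t + 0 * (t' - t).
    apply: cvgD; first exact: cvg_cst.
    by apply: cvgM; [exact: cvg_within|exact: cvg_cst].
  by rewrite mul0r addr0.
near (0 : R)^'+ => l.
have l0 : 0 < l by near: l; exact: nbhs_right_gt.
have l1 : l < 1 by near: l; exact: nbhs_right_lt.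
exists (t + l * (t' - t)); split.
  by rewrite addrC -subr_eq0 addrK mulf_neq0 ?subr_eq0// gt_eqF.
have : edge_dom e (t + l * (t' - t)).
  have [tt|tt] := leP t t'.
    by apply: edge_dom_interval et et' _ _; apply/andP; split; nra.
  by apply: edge_dom_interval et' et _ _; apply/andP; split; nra.
near: l; exact: cv Pt.
Unshelve. all: by end_near.
Qed.

End Edges.

Section Slopes.
Variables (R : realType) (n : nat) (M : ia_manifold R n).
Variables (G : metric_graph R) (h : G -> M).
Hypothesis hP : is_parametrized_curve h.
Implicit Types (e : gedge G) (c : chart R M n) (t : R).

Let GP : is_tropical_curve G := pc_curve hP.

Lemma has_slope_uniq e c t v v' : edge_dom e t ->
  has_slope h e c t v -> has_slope h e c t v' -> v = v'.
Proof.
move=> et hv hv'.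
have [s [st [-> /addrI E]]] := edge_near_neq GP et (filterI hv hv').
apply/matrixP => i j.
have /matrixP/(_ i j) : map_mx intr v = map_mx intr v' :> 'cV[R]_n.
  by apply: scalerI E; rewrite subr_eq0.
by rewrite !mxE => /intr_inj.
Qed.

Lemma slopeP e c t : edge_dom e t -> ia_atlas c -> cdom c (h (gpar e t)) ->
  has_slope h e c t (slope h e c t).
Proof.
move=> et ac ch; have [v hv] := pc_affine hP et ac ch.
by apply: xgetPex; exists v.
Qed.

Lemma slope_eq e c t v : edge_dom e t -> has_slope h e c t v ->
  slope h e c t = v.
Proof.
move=> et hv.
have hs : has_slope h e c t (slope h e c t) by apply: xgetPex; exists v.
exact: has_slope_uniq et hs hv.
Qed.

(** Continuity of [h] along a closed edge. Continuity of [gpar e] there is contained in the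
    description [g_open] of the quotient topology. *)
Lemma near_gpar e t (U : set M) : edge_dom e t -> nbhs (h (gpar e t)) U ->
  \forall s \near within (edge_dom e) (nbhs t), U (h (gpar e s)).
Proof.
move=> et Uh.
have [hcont _] := pc_proper hP.
have oV : open (h @^-1` U°).
  by apply: open_comp (open_interior U) => x _; exact: hcont.
have [/(_ oV e)[W oW WE] _] := g_open GP (h @^-1` U°).
have Wt : W t.
  have : (gpar e @^-1` (h @^-1` U°) `&` edge_dom e) t by split=> //; exact: Uh.
  by rewrite WE => -[].
have nW : nbhs t W by exact: open_nbhs_nbhs.
apply: filterS nW => s Ws es.
have : (W `&` edge_dom e) s by [].
by rewrite -WE => -[/= /interior_subset].
Qed.

Lemma has_slope_near e c t v : edge_dom e t -> has_slope h e c t v ->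
  \forall s \near within (edge_dom e) (nbhs t), has_slope h e c s v.
Proof.
move=> et hv; have := nbhs_interior hv; apply: filterS => s hs es.
have hse := interior_subset hs es.
apply: filterS hs => r hr er; rewrite hr//.
by rewrite hse -addrA -scalerDl [s - t + _]addrC subrKA.
Qed.

Lemma has_slope_change c d e t v (A : 'M[int]_n) (x0 : 'cV[R]_n) :
  edge_dom e t -> affine_change c d (h (gpar e t)) A x0 ->
  has_slope h e c t v -> has_slope h e d t (A *m v).
Proof.
move=> et cd; have := near_gpar et cd; apply: filterS2 => s hd hc.
rewrite hd hc (nbhs_singleton cd) mulmxDr addrAC -scalemxAr.
by rewrite map_mxM.
Qed.

End Slopes.

(** * Values of a tropical form *)

(** Since the maps [phi i] kill the translation parts, a change of chart within [At] acts on the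
    images of coordinates under [phi i] through its integral matrix alone. *)
Record killed_atlas (R : realType) (n : nat) (B : ia_manifold R n) (p : nat)
    (At : set (chart R B n)) (phi : 'I_p -> {additive R -> rat}) : Prop :=
  KilledAtlas {
  ka_sub : At `<=` @ia_atlas R n B;
  ka_cover : forall b, exists2 c, At c & cdom c b;
  ka_transition : forall c d b, At c -> At d -> cdom c b -> cdom d b ->
    exists A x0, [/\ A \in unitmx, affine_change c d b A x0 &
      forall i j, phi i (x0 j 0) = 0] }.

Section Evaluation.
Variables (R : realType) (n : nat) (B : ia_manifold R n) (p : nat).
Variables (w : tropical_form B p) (At : set (chart R B n)).
Variable phi : 'I_p -> {additive R -> rat}.
Implicit Types (b : B) (c d : chart R B n).

Definition phi_coord c b : 'I_p -> 'cV[rat]_n := fun i => map_mx (phi i) (c b).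

Definition form_at c b := ratext (w c b).

(** The contraction of [w /\ dt] with the integral vector [s], evaluated at the images under the
    [phi i] of the coordinates of [x] on the cylinder. *)
Definition flux c (x : cylinder B) (s : 'cV[int]_(n + 1)) : rat :=
  contr (form_at c x.1) (map_mx intr (usubmx s)) (s (rshift n 0) 0)%:~R
    (phi_coord c x.1) (fun i => phi i x.2).

Definition form_value b : rat :=
  xget 0 [set q | exists c, [/\ At c, cdom c b & q = form_at c b (phi_coord c b)]].

Hypothesis AtP : killed_atlas At phi.

Let At_sub := ka_sub AtP.
Let At_transition := ka_transition AtP.

Lemma form_at_mlin c b : At c -> cdom c b -> mlin (form_at c b).
Proof. by move=> /At_sub ac cb; exact: ratext_mlin. Qed.

Lemma form_at_alt c b : At c -> cdom c b -> malt (form_at c b).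
Proof.
move=> /At_sub ac cb.
exact: ratext_alt (tf_multilinear w ac cb) (tf_alternating w ac cb).
Qed.

Lemma form_at_change c d b (A : 'M[int]_n) (x0 : 'cV[R]_n) V :
  At c -> At d -> cdom c b -> cdom d b ->
  A \in unitmx -> affine_change c d b A x0 ->
  form_at c b V = form_at d b (fun i => map_mx intr A *m V i).
Proof.
move=> /At_sub ac /At_sub ad cb db uA cd; 
apply: (ratext_mulmx (tf_multilinear w ac cb) (tf_multilinear w ad db)) => U.
exact: (tf_transition w ac ad cb db uA cd U).
Qed.

Lemma phi_coord_change c d b (A : 'M[int]_n) (x0 : 'cV[R]_n) :
  affine_change c d b A x0 ->
  (forall i j, phi i (x0 j 0) = 0) ->
  phi_coord d b = fun i => map_mx intr A *m phi_coord c b i.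
Proof.
move=> /nbhs_singleton cd phi0; apply/funext => i.
rewrite /phi_coord cd -map_mx_intmul; apply/matrixP => j k.
by rewrite !mxE ord1 raddfD /= phi0 addr0.
Qed.

(** Independence of the chart: the integral matrix of a transition acts compatibly on the form and
    on its arguments, and the translation is invisible to [phi]. *)
Lemma form_valueE c b : At c -> cdom c b ->
  form_value b = form_at c b (phi_coord c b).
Proof.
move=> ac cb; rewrite /form_value; case: xgetP => [_ _ [d [ad db ->]]|nq]; last first.
  by case: (nq (form_at c b (phi_coord c b))); exists c.
have [A [x0 [uA cd phi0]]] := At_transition ac ad cb db.
by rewrite (form_at_change _ ac ad cb db uA cd) (phi_coord_change cd phi0).
Qed.

Definition cyl_matrix (A : 'M[int]_n) : 'M[int]_(n + 1) := block_mx A 0 0 1%:M.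

Lemma flux_change c d x (A : 'M[int]_n) (x0 : 'cV[R]_n) s :
  At c -> At d -> cdom c x.1 -> cdom d x.1 ->
  A \in unitmx -> affine_change c d x.1 A x0 ->
  (forall i j, phi i (x0 j 0) = 0) ->
  flux c x s = flux d x (cyl_matrix A *m s).
Proof.
move=> ac ad cb db uA cd phi0; rewrite /flux.
have -> : cyl_matrix A *m s = col_mx (A *m usubmx s) (dsubmx s).
  rewrite -[X in _ *m X](vsubmxK s) mul_block_col.
  by rewrite !mul0mx mul1mx addr0 add0r.
rewrite col_mxKu col_mxEd mxE map_mxM /contr.
rewrite (form_at_change _ ac ad cb db uA cd) (phi_coord_change cd phi0).
congr (_ - _); apply: eq_bigr => i _; congr (_ * _).
rewrite (form_at_change _ ac ad cb db uA cd); congr form_at; apply/funext => j.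
by have [<-|ij] := eqVneq i j; rewrite ?dfwithin// !dfwithout.
Qed.

Lemma fluxD c x s s' : At c -> cdom c x.1 ->
  flux c x (s + s') = flux c x s + flux c x s'.
Proof.
move=> ac cx; rewrite /flux -contrD; last exact: form_at_mlin.
by rewrite mxE rmorphD/= !linearD/= map_mxD.
Qed.

Lemma flux0 c x : At c -> cdom c x.1 -> flux c x 0 = 0.
Proof.
move=> ac cx; rewrite /flux mxE linear0 map_mx0 contr0//.
exact: form_at_mlin.
Qed.

Lemma fluxN c x s : At c -> cdom c x.1 -> flux c x (- s) = - flux c x s.
Proof.
move=> ac cx; apply/eqP; rewrite -addr_eq0 -fluxD// addNr flux0//.
Qed.

Lemma flux_sum c x (J : Type) (r : seq J) (P : pred J) (F : J -> 'cV[int]_(n + 1)) :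
  At c -> cdom c x.1 ->
  flux c x (\sum_(j <- r | P j) F j) = \sum_(j <- r | P j) flux c x (F j).
Proof.
move=> ac cx; apply: (big_morph (flux c x)); last exact: flux0.
by move=> s s'; exact: fluxD.
Qed.

(** All terms of the contraction but the first have a zero argument. *)
Lemma flux_vertical c x s : At c -> cdom c x.1 -> usubmx s = 0 ->
  flux c x s = (s (rshift n 0) 0)%:~R * form_value x.1.
Proof.
move=> ac cx s0; rewrite /flux /contr s0 map_mx0 big1 ?subr0.
  by rewrite (form_valueE ac).
by move=> i _; rewrite mlin0 ?mulr0//; exact: form_at_mlin.
Qed.

(** Because [s] is integral, the displacement [a *: s] moves the [i]-th argument by [phi i a] times
    [s]. This is the motion treated by [contr_flow], with [q i = phi i a]. *)
Lemma flux_flow c x y a s : At c -> cdom c x.1 -> w c y.1 = w c x.1 ->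
  cyl_chart c y = cyl_chart c x + a *: map_mx intr s ->
  flux c y s = flux c x s.
Proof.
move=> ac cx wxy /= xy.
have [xy1 xy2] : c y.1 = c x.1 + a *: map_mx intr (usubmx s) /\
    y.2 = x.2 + a * (s (rshift n 0) 0)%:~R.
  move: xy; rewrite -{1}(vsubmxK s) map_col_mx scale_col_mx add_col_mx.
  move=> /eq_col_mx[-> /matrixP /(_ 0 0)]; rewrite !mxE => ->; split=> //.
rewrite /flux /form_at wxy -/(form_at c x.1).
rewrite -[RHS](contr_flow _ _ _ _ _ _ (fun i => phi i a)).
- congr contr; apply/funext => i.
    by rewrite /phi_coord xy1 map_mxD map_mx_scaleint.
  by rewrite xy2 raddfD /= additive_mulrint.
- exact: form_at_mlin.
- exact: form_at_alt.
Qed.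

End Evaluation.

(** * Conservation of flux along a tropical curve *)

Section CurveFlux.
Variables (R : realType) (n : nat) (B : ia_manifold R n) (p : nat).
Variables (w : tropical_form B p) (At : set (chart R B n)).
Variable phi : 'I_p -> {additive R -> rat}.
Hypothesis AtP : killed_atlas At phi.
Variables (G : metric_graph R) (h : G -> cylinder B).
Hypothesis hP : is_parametrized_curve h.
Implicit Types (e : gedge G) (c d : chart R B n) (t : R).

Let GP : is_tropical_curve G := pc_curve hP.

Lemma cyl_atlasP c : At c -> @ia_atlas _ _ (cylinder B) (cyl_chart c).
Proof. by move=> /(ka_sub AtP) ac; exists c. Qed.

Lemma cyl_affine_change c d (x : cylinder B) (A : 'M[int]_n) (x0 : 'cV[R]_n) :
  affine_change c d x.1 A x0 ->
  affine_change (cyl_chart c) (cyl_chart d) x (cyl_matrix A) (col_mx x0 0).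
Proof.
rewrite /affine_change => cd.
have : \forall z \near x, d z.1 = map_mx intr A *m c z.1 + x0 by exact: cvg_fst cd.
apply: filterS => -[y t] /= ->.
rewrite map_block_mx !raddf0 map_scalar_mx mul_block_col !mul0mx addr0 add0r.
by rewrite rmorph1 mul1mx add_col_mx addr0.
Qed.

Lemma cyl_cdom c (x : cylinder B) : cdom c x.1 -> cdom (cyl_chart c) x.
Proof. by []. Qed.

Lemma cyl_slopeP c e t : edge_dom e t -> At c -> cdom c (h (gpar e t)).1 ->
  has_slope h e (cyl_chart c) t (slope h e (cyl_chart c) t).
Proof. by move=> et ac ch; apply: slopeP => //; exact: cyl_atlasP. Qed.

Lemma slope_change c d e t (A : 'M[int]_n) (x0 : 'cV[R]_n) : edge_dom e t ->
  At c -> At d -> cdom c (h (gpar e t)).1 -> cdom d (h (gpar e t)).1 ->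
  affine_change c d (h (gpar e t)).1 A x0 ->
  slope h e (cyl_chart d) t = cyl_matrix A *m slope h e (cyl_chart c) t.
Proof.
move=> et ac ad cb db cd; apply: slope_eq => //.
apply: has_slope_change (cyl_slopeP et ac cb) => //.
exact: cyl_affine_change cd.
Qed.


Definition edge_flux e t : rat :=
  xget 0 [set q | exists c, [/\ At c, cdom c (h (gpar e t)).1 &
    q = flux w phi c (h (gpar e t)) (slope h e (cyl_chart c) t)]].

Lemma edge_fluxE c e t : edge_dom e t -> At c -> cdom c (h (gpar e t)).1 ->
  edge_flux e t = flux w phi c (h (gpar e t)) (slope h e (cyl_chart c) t).
Proof.
move=> et ac cb; rewrite /edge_flux.
case: xgetP => [_ _ [d [ad db ->]]|nq]; last first.
  by case: (nq (flux w phi c (h (gpar e t)) (slope h e (cyl_chart c) t))); exists c.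
have [A [x0 [uA cd phi0]]] := ka_transition AtP ac ad cb db.
rewrite (flux_change _ AtP _ ac ad cb db uA cd phi0).
by rewrite (slope_change et ac ad cb db cd).
Qed.

Lemma near_edge c e t : edge_dom e t -> At c -> cdom c (h (gpar e t)).1 ->
  \forall s \near within (edge_dom e) (nbhs t),
    [/\ cdom c (h (gpar e s)).1, w c (h (gpar e s)).1 = w c (h (gpar e t)).1,
        cyl_chart c (h (gpar e s)) = cyl_chart c (h (gpar e t)) +
          (s - t) *: map_mx intr (slope h e (cyl_chart c) t) &
        edge_dom e s ->
        slope h e (cyl_chart c) s = slope h e (cyl_chart c) t].
Proof.
move=> et ac cb; have bc := ka_sub AtP ac.
have hs := cyl_slopeP et ac cb.
have n1 : nbhs (h (gpar e t)) [set x : cylinder B | cdom c x.1].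
  apply: (cvg_fst (F := nbhs (h (gpar e t)).1)).
  by apply: open_nbhs_nbhs; split=> //; apply: cdom_open; exact: ia_chart bc.
have n2 : nbhs (h (gpar e t)) [set x : cylinder B | w c x.1 = w c (h (gpar e t)).1].
  exact: (cvg_fst (F := nbhs (h (gpar e t)).1)) (tf_locally_constant w bc cb).
near=> s; split.
- by near: s; exact: (near_gpar hP et n1).
- by near: s; exact: (near_gpar hP et n2).
- by near: s; exact: hs.
- move=> es; apply: slope_eq => //.
  by near: s; exact: has_slope_near.
Unshelve. all: by end_near.
Qed.

Lemma edge_flux_const e t : edge_dom e t -> edge_flux e t = edge_flux e 0.
Proof.
apply: edge_locally_constant => // {}t et.
have [c ac cb] := ka_cover AtP (h (gpar e t)).1.
have := near_edge et ac cb; rewrite !near_withinE; apply: filterS => s H es.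
have [cs ws hs ss] := H es.
rewrite (edge_fluxE es ac cs) (edge_fluxE et ac cb) (ss es).
exact: (flux_flow AtP ac cb ws hs).
Qed.

(** Kirchhoff's law: the flux at [h x] is additive in the slope, so it can be applied to the
    balancing condition. The minus sign of the edges ending at [x] puts them on the other side. *)
Lemma vertex_flux x : gvert x ->
  \sum_(e | starts_at x e) edge_flux e 0 =
  \sum_(e | ends_at x e) edge_flux e (fine (glen e)).
Proof.
move=> vx; have [c ac cx] := ka_cover AtP (h x).1.
have bal := pc_balanced hP vx (cyl_atlasP ac) (cyl_cdom cx).
have := etrans (esym (fluxD w AtP _ _ ac cx))
  (etrans (congr1 (flux w phi c (h x)) bal) (flux0 w AtP ac cx)).
rewrite sumrN (fluxN w AtP _ ac cx) => /eqP; rewrite subr_eq0 => /eqP.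
rewrite (flux_sum w AtP _ _ _ ac cx) [X in _ = X](flux_sum w AtP _ _ _ ac cx) => E.
transitivity (\sum_(e | starts_at x e) flux w phi c (h x) (slope h e (cyl_chart c) 0)).
  apply: eq_bigr => e /eqP ex; rewrite (edge_fluxE (edge_dom0 GP e) ac) ex//.
rewrite E; apply: eq_bigr => e /andP[fe /eqP ex].
by rewrite (edge_fluxE (edge_dom_end GP fe) ac) ex.
Qed.

(** Summing Kirchhoff's law over the vertices counts every edge once at its start and every bounded
    edge once at its end, where the flux is the same as at the start. *)
Lemma total_flux : \sum_e edge_flux e 0 =
  \sum_(e | glen e \is a fin_num) edge_flux e 0.
Proof.
(* The vertices that are end points of some edge, each listed once; [regroup] sorts the edges by a
   chosen end point. *)
pose s := undup ([seq gpar e 0 | e <- index_enum (gedge G)] ++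
  [seq gpar e (fine (glen e)) | e <- index_enum (gedge G) & glen e \is a fin_num]).
have vs x : x \in s -> gvert x.
  rewrite mem_undup mem_cat => /orP[/mapP[e _ ->]|/mapP[e]].
    exact: gpar_start.
  by rewrite mem_filter => /andP[fe _] ->; exact: gpar_end.
have regroup (P : pred (gedge G)) (F : gedge G -> rat) (v : gedge G -> G) :
    (forall e, P e -> v e \in s) ->
    \sum_(e | P e) F e = \sum_(x <- s) \sum_(e | P e && (v e == x)) F e.
  move=> Ps; rewrite (exchange_big_dep P) /=; last by move=> x e _ /andP[].
  apply: eq_bigr => e Pe; rewrite Pe -big_filter.
  rewrite (@perm_big _ _ _ _ _ [:: v e]) ?big_seq1//.
  apply: uniq_perm => //; first by rewrite filter_uniq// undup_uniq.
  move=> x; rewrite mem_filter inE eq_sym; case: eqVneq => //= ->.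
  exact: Ps.
have v0 e : gpar e 0 \in s.
  by rewrite mem_undup mem_cat; apply/orP; left; apply: map_f; rewrite mem_index_enum.
have v1 e : glen e \is a fin_num -> gpar e (fine (glen e)) \in s.
  move=> fe; rewrite mem_undup mem_cat; apply/orP; right.
  by apply: map_f; rewrite mem_filter fe mem_index_enum.
rewrite (regroup _ _ (fun e => gpar e 0)) => [|e _]; last exact: v0.
transitivity (\sum_(e | glen e \is a fin_num) edge_flux e (fine (glen e))).
  rewrite (regroup _ _ (fun e => gpar e (fine (glen e)))) => [|e]; last exact: v1.
  by apply: eq_big_seq => x /vs/vertex_flux.
by apply: eq_bigr => e fe; rewrite edge_flux_const//; exact: edge_dom_end.
Qed.

End CurveFlux.

Section AffineLimits.
Variable R : realType.

Lemma cvg_affine (u : R -> R) (a b : R) : 0 < a ->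
  (forall t, 0 <= t -> u t = b + t * a) -> u t @[t --> +oo] --> +oo.
Proof.
move=> a0 uE; apply/cvgryPge => A; near=> t.
have t0 : 0 <= t by near: t; exact: nbhs_pinfty_ge.
rewrite uE// -lerBlDl -ler_pdivrMr//.
Unshelve. all: by end_near.
Qed.

Lemma cvg_affineN (u : R -> R) (a b : R) : a < 0 ->
  (forall t, 0 <= t -> u t = b + t * a) -> u t @[t --> +oo] --> -oo.
Proof.
move=> a0 uE; apply/cvgNry; apply: (@cvg_affine _ (- a) (- b)); rewrite ?oppr_gt0//.
by move=> t t0 /=; rewrite uE//; ring.
Qed.

Lemma cvg_pinftyN (u : R -> R) : u t @[t --> +oo] --> +oo ->
  ~ u t @[t --> +oo] --> -oo.
Proof.
move=> /cvgryPgt/(_ 0) u0 /cvgrNyPlt/(_ 0) u1.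
have [t [/= a b]] := filter_ex (filterI u0 u1).
by have := lt_trans a b; rewrite ltxx.
Qed.

End AffineLimits.

(** * Flux through the unbounded edges *)

Section EndCycle.
Variables (R : realType) (n : nat) (B : ia_manifold R n) (p : nat).
Variables (w : tropical_form B p) (At : set (chart R B n)).
Variable phi : 'I_p -> {additive R -> rat}.
Hypothesis AtP : killed_atlas At phi.
Variables (G : metric_graph R) (h : G -> cylinder B).
Hypothesis hP : is_parametrized_curve h.
Hypothesis hH : horizontal_at_infinity h.
Implicit Types (e : gedge G) (c d : chart R B n) (t : R).

Let GP : is_tropical_curve G := pc_curve hP.

(** By horizontality the edge lies over one point of [B], so a single chart serves all of it and the
    slope has no component along [B]. *)
Lemma infinite_edge c e : glen e = +oo%E -> At c -> cdom c (h (gpar e 0)).1 ->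
  let s := slope h e (cyl_chart c) 0 in
  usubmx s = 0 /\ forall t, 0 <= t ->
    (h (gpar e t)).2 = (h (gpar e 0)).2 + t * (s (rshift n 0) 0)%:~R.
Proof.
move=> ge ac cb s.
have cbt t : edge_dom e t -> cdom c (h (gpar e t)).1.
  by move=> [t0 _]; rewrite hH.
have split_chart t t' v : edge_dom e t -> edge_dom e t' ->
    cyl_chart c (h (gpar e t')) = cyl_chart c (h (gpar e t)) +
      (t' - t) *: map_mx intr v ->
    (t' - t) *: map_mx intr (usubmx v) = 0 :> 'cV[R]_n /\
    (h (gpar e t')).2 = (h (gpar e t)).2 + (t' - t) * (v (rshift n 0) 0)%:~R.
  move=> [t0 _] [t'0 _] /=.
  rewrite -{1}(vsubmxK v) map_col_mx scale_col_mx add_col_mx.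
  move=> /eq_col_mx[E /matrixP /(_ 0 0)]; rewrite !mxE => ->; split=> //.
  by apply: (addrI (c (h (gpar e t)).1)); rewrite -E addr0 !(hH ge).
split.
  have hs := cyl_slopeP AtP hP (edge_dom0 GP e) ac cb.
  have hd : \forall t \near within (edge_dom e) (nbhs 0), edge_dom e t.
    by rewrite near_withinE; near=> t.
  have [t [t0 [ht et]]] := edge_near_neq GP (edge_dom0 GP e) (filterI hs hd).
  have [E _] := split_chart _ _ _ (edge_dom0 GP e) et ht.
  apply/matrixP => i j; have /matrixP/(_ i j) := E; rewrite !mxE subr0 => /eqP.
  by rewrite mulf_eq0 (negbTE t0) intr_eq0 => /eqP.
move=> t t0; have et := edge_dom_infty ge t0.
(* The slope and the intercept of the height are locally constant, hence constant, so the height is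
   affine on the whole edge. *)
pose f t := (slope h e (cyl_chart c) t,
  (h (gpar e t)).2 - t * (slope h e (cyl_chart c) t (rshift n 0) 0)%:~R).
have : f t = f 0.
  apply: edge_locally_constant et => // {t0}t et.
  have := near_edge w AtP hP et ac (cbt _ et).
  rewrite !near_withinE; apply: filterS => r H er; have [_ _ hr sr] := H er.
  have [_ E] := split_chart _ _ _ et er hr.
  rewrite /f (sr er) E; congr (_, _); ring.
rewrite /f => -[-> E]; rewrite -/s in E *.
by rewrite -[LHS](subrK (t * (s (rshift n 0) 0)%:~R)) E mul0r subr0.
Unshelve. all: by end_near.
Qed.

Variable m : gedge G -> nat.
Hypothesis mP : forall e, is_weight h e (m e).

(** The slope is vertical and equals [m e] times a primitive vector, so its height component is plus
    or minus the weight. The sign decides both the direction of the end and the sign of the flux. *)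
Lemma infinite_edge_flux e : glen e = +oo%E ->
  [/\ up_end h e, ~ down_end h e &
     edge_flux w At phi h e 0 = (m e)%:R * form_value w At phi (h (gpar e 0)).1] \/
  [/\ ~ up_end h e, down_end h e &
     edge_flux w At phi h e 0 = - ((m e)%:R * form_value w At phi (h (gpar e 0)).1)].
Proof.
move=> ge; have [c ac cb] := ka_cover AtP (h (gpar e 0)).1.
have [us ht] := infinite_edge ge ac cb.
set s := slope _ _ _ _ in us ht.
have [m0 mu] := mP e.
have [u up su] := mu _ _ (edge_dom0 GP e) (cyl_atlasP AtP ac) (cyl_cdom cb).
have m0' : (m e)%:R != 0 :> int by rewrite pnatr_eq0 -lt0n.
(* A primitive vector that is a multiple of the vertical unit vector has coefficient 1 or -1. *)
have uE : u = u (rshift n 0) 0 *: col_mx 0 1%:M.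
  rewrite -[LHS]vsubmxK scale_col_mx scaler0; congr col_mx.
    apply/matrixP => i j; move/matrixP/(_ i j): us; rewrite /s su -scaler_nat !mxE.
    by move/eqP; rewrite mulf_eq0 (negbTE m0') => /eqP.
  by apply/matrixP => i j; rewrite !mxE !ord1 mulr1.
have sE : s (rshift n 0) 0 = (m e)%:R * u (rshift n 0) 0.
  by rewrite /s su -scaler_nat mxE.
have uz := up _ _ uE.
rewrite (edge_fluxE w AtP hP (edge_dom0 GP e) ac cb) (flux_vertical w AtP)// -/s sE.
have M0 : 0 < (m e)%:R :> R by rewrite ltr0n.
have [u1|u1] : u (rshift n 0) 0 = 1 \/ u (rshift n 0) 0 = -1.
  by move: uz; rewrite unfold_in => /orP[] /eqP; [left|right].
- left; rewrite u1 mulr1 in sE *.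
  have hu : (h (gpar e t)).2 @[t --> +oo] --> +oo.
    apply: (cvg_affine (b := (h (gpar e 0)).2) M0) => t t0.
    by rewrite ht// sE rmorph_nat.
  split; [by []|by case=> _ /(cvg_pinftyN hu)|by rewrite rmorph_nat].
- right; rewrite u1 mulrN1 in sE *.
  have hu : (h (gpar e t)).2 @[t --> +oo] --> -oo.
    apply: (cvg_affineN (a := - (m e)%:R) (b := (h (gpar e 0)).2)).
      by rewrite oppr_lt0.
    by move=> t t0; rewrite ht// sE rmorphN rmorph_nat.
  split; [by case=> _ /cvg_pinftyN|by []|].
  by rewrite rmorphN rmorph_nat mulNr.
Qed.

(** Cancelling the bounded edges in [total_flux] leaves zero as the total flux of the unbounded
    ones. *)
Lemma end_flux :
  \sum_(e | `[< up_end h e >]) (m e)%:R * form_value w At phi (h (gpar e 0)).1 -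
  \sum_(e | `[< down_end h e >]) (m e)%:R * form_value w At phi (h (gpar e 0)).1 = 0.
Proof.
have := total_flux w AtP hP; rewrite (bigID (fun e => glen e \is a fin_num)) /=.
rewrite -[RHS]addr0 => /addrI E; rewrite -[RHS]E.
rewrite -sumrN big_mkcond [X in _ + X]big_mkcond -big_split /= [RHS]big_mkcond.
apply: eq_bigr => e _.
have [fe|/(glen_infty GP)/infinite_edge_flux] := boolP (glen e \is a fin_num).
  rewrite !asboolF ?addr0// => -[ge _]; by rewrite ge in fe.
case=> -[u d ->].
  by rewrite (asboolT u) (asboolF d) addr0.
by rewrite (asboolF u) (asboolT d) add0r.
Qed.

End EndCycle.

(** * The induced homomorphism on 0-cycles *)

Section CycleValue.
Variables (R : realType) (n : nat) (B : ia_manifold R n) (p : nat).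
Variables (w : tropical_form B p) (At : set (chart R B n)).
Variable phi : 'I_p -> {additive R -> rat}.

Definition cycle_value (z : {freeg B}) : rat :=
  fglift (form_value w At phi : B -> zmodule rat) z.

Lemma cycle_value_is_additive : zmod_morphism cycle_value.
Proof. exact: (lift_is_additive (form_value w At phi : B -> zmodule rat)). Qed.

HB.instance Definition _ :=
  GRing.isZmodMorphism.Build {freeg B} rat cycle_value cycle_value_is_additive.

Lemma cycle_valueU b : cycle_value << b >> = form_value w At phi b.
Proof. by rewrite /cycle_value liftU scale1r. Qed.

Hypothesis AtP : killed_atlas At phi.

Lemma cycle_value_R0 (z : {freeg B}) : @R0 R n B z -> cycle_value z = 0.
Proof.
(* The kernel is a subgroup, so it is enough that it contains the generators of [R0]; this is
   [end_flux]. *)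
pose K := [set z : {freeg B} | cycle_value z = 0].
suff : @R0 R n B `<=` K by exact.
apply: smallest_sub.
  split=> [|x y /set_mem Kx /set_mem Ky]; apply/mem_set; rewrite /K /=.
    exact: raddf0.
  by rewrite raddfB /= Kx Ky subrr.
move=> _ [G [h [m [hP hH mP ->]]]]; rewrite /K /= /end_cycle raddfB !raddf_sum /=.
rewrite -[RHS](end_flux w AtP hP hH mP).
rewrite -[in RHS]sumrN; congr (_ + _); apply: eq_bigr => e _;
  by rewrite raddfMn /= cycle_valueU mulr_natl.
Qed.

Lemma cycle_value_ch0 (z z' : {freeg B}) :
  ch0 z = ch0 z' -> cycle_value z = cycle_value z'.
Proof.
move=> /eqP; rewrite /ch0 -Quotient.idealrBE => zz.
apply/eqP; rewrite -subr_eq0 -raddfB; apply/eqP.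
by apply: cycle_value_R0; exact/set_mem.
Qed.

End CycleValue.

(** * Existence of test points and test functionals *)

Lemma countable_enum (T : pointedType) (A : set T) : countable A ->
  exists u : nat -> T, A `<=` range u.
Proof.
move=> /countable_injP[f fi]; exists (fun k => xget point [set x | A x /\ f x = k]).
move=> x Ax; exists (f x) => //; case: xgetP => [y _ [Ay fy]|/(_ x)[]//].
by apply: fi fy; exact/mem_set.
Qed.

(** A countable base [P] makes countably many choices suffice: a chart for each base set that lies
    in a chart domain, and an affine transition for each triple of base sets admitting one. [T]
    collects the entries of the chosen translations. *)
Lemma countable_subatlas (R : realType) (n : nat) (B : ia_manifold R n) :
  exists (At : set (chart R B n)) (T : set R),
    [/\ At `<=` @ia_atlas R n B, forall b, exists2 c, At c & cdom c b,
        countable T &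
        forall c d b, At c -> At d -> cdom c b -> cdom d b ->
          exists A x0, [/\ A \in unitmx, affine_change c d b A x0 &
            forall j, T (x0 j 0)]].
Proof.
have [P cP [oP bP]] := @ia_second_countable _ _ B.
pose good (D : set B) (c : chart R B n) := ia_atlas c /\ D `<=` cdom c.
have /choice[f fP] D : exists c, (exists c', good D c') -> good D c.
  have [[c gc]|ng] := pselect (exists c, good D c); first by exists c.
  by exists (Chart set0 (fun=> 0)).
(* For a triple [(D, D', E)], the pair [z] describes on all of [E] the passage from the chart chosen
   for [D] to that chosen for [D']. *)
pose change (t : set B * set B * set B) (z : 'M[int]_n * 'cV[R]_n) :=
  z.1 \in unitmx /\ forall y, t.2 y -> f t.1.2 y = map_mx intr z.1 *m f t.1.1 y + z.2.
have /choice[g gP] t : exists z, (exists z', change t z') -> change t z.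
  have [[z gz]|ng] := pselect (exists z, change t z); first by exists z.
  by exists (1%:M, 0).
exists [set c | exists D, [/\ P D, good D c & c = f D]].
exists [set (g t.1).2 t.2 0 | t in (P `*` P `*` P) `*` [set: 'I_n]]; split.
- by move=> c [D [_ [ac _] _]].
- move=> b; have [c ac cb] := ia_cover b.
  have nc : nbhs b (cdom c).
    by apply: open_nbhs_nbhs; split=> //; exact: cdom_open (ia_chart ac).
  have [D [PD Db] Dc] := bP b _ nc.
  have gD : good D (f D) by apply: fP; exists c.
  by exists (f D); [exists D|apply: gD.2].
- apply: card_le_trans (card_image_le _ _) _.
  by do 3! apply: countableX => //.
- move=> c d b [D [PD gc cE]] [D' [PD' gd dE]]; subst c d => cb db.
  have [[aD _] [aD' _]] := (gc, gd).
  have [A [x0 [uA cd]]] := ia_transition aD aD' cb db.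
  have [E [PE Eb] Ecd] := bP b _ cd.
  have [uA' gE] : change (D, D', E) (g (D, D', E)).
    by apply: gP; exists (A, x0); split=> // y /Ecd.
  exists (g (D, D', E)).1, (g (D, D', E)).2; split=> //.
    have nE : nbhs b E by apply: open_nbhs_nbhs; split=> //; exact: oP.
    by apply: filterS nE => y Ey; exact: gE.
  by move=> j; exists ((D, D', E), j).
Qed.

Lemma additive_functional (R : realType) (M : set R) y : qclosed M -> ~ M y ->
  exists phi : {additive R -> rat}, (forall x, M x -> phi x = 0) /\ phi y = 1.
Proof.
move=> Mc My; have [phi [phiD phi0 phi1]] := qclosed_functional Mc My.
have phiB : zmod_morphism phi.
  move=> a b; apply: (addIr (phi b)); by rewrite -phiD !subrK.
pose H := GRing.isZmodMorphism.Build R rat phi phiB.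
pose f : {additive R -> rat} := HB.pack phi H.
by exists f.
Qed.

Lemma chart_box (R : realType) (n : nat) (B : ia_manifold R n)
    (c : chart R B n) b (N : set B) : ia_atlas c -> cdom c b -> nbhs b N ->
  exists2 e : R, 0 < e & forall v : 'cV[R]_n,
    (forall j, `|v j 0 - c b j 0| < e) -> exists y, [/\ N y, cdom c y & c y = v].
Proof.
move=> ac cb nN; have cc := ia_chart ac.
have oc := cdom_open cc.
pose U := N° `&` cdom c.
have oU : open (c @` U).
  by apply: cmap_open => //; [apply: openI => //; exact: open_interior|move=> x []].
have /nbhs_ballP[e e0 eU] : nbhs (c b) (c @` U).
  by apply: open_nbhs_nbhs; split=> //; exists b => //; split=> //; exact: nN.
exists e => // v vb.
have [|y [/interior_subset Ny cy] <-] := eU v; last by exists y.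
split=> // i j; rewrite ord1 /ball /= distrC; exact: vb.
Qed.

Lemma mlin_coord0 (K : comNzRingType) (n p : nat)
    (f : ('I_p -> 'cV[K]_n) -> K) V i : mlin f -> V i = 0 -> f V = 0.
Proof. by move=> fM Vi; rewrite -(dfwith_id V i) Vi mlin0. Qed.

(** Every term with [j] other than [i] repeats the vector [U j] and vanishes. *)
Lemma malt_combination (K : comNzRingType) (n p : nat)
    (f : ('I_p -> 'cV[K]_n) -> K) (q : 'I_p -> K) (U : 'I_p -> 'cV[K]_n) i :
  mlin f -> malt f -> q i = 1 -> f (dfwith U i (\sum_j q j *: U j)) = f U.
Proof.
move=> fM fA qi; rewrite mlin_sum// (bigD1 i)//= mlinZ// qi mul1r dfwith_id.
rewrite big1 ?addr0// => j ji; rewrite mlinZ// (@fA _ i j) ?mulr0//.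
  by rewrite eq_sym.
by rewrite dfwithin dfwithout// eq_sym.
Qed.

(** The exchange lemma, applied to the [N] numbers [y (i, j0)], finds [i0] and a functional [phi j0]
    that kills all [c a]. For [m] other than [j0], independence allows [phi m] to be dual to
    [y (i0, m)] within the family [y]. *)
Lemma test_functionals (R : realType) (M : set R) (N p : nat) (C : finType)
    (y : 'I_N * 'I_p -> R) (c : C -> R) (j0 : 'I_p) :
  qclosed M -> qindep M y -> (#|C| < N)%N ->
  exists (i0 : 'I_N) (phi : 'I_p -> {additive R -> rat}),
    [/\ forall m x, M x -> phi m x = 0, forall a, phi j0 (c a) = 0,
        phi j0 (y (i0, j0)) = 1 &
        forall m, m != j0 -> forall a, phi m (y a) = (a == (i0, m))%:R].
Proof.
move=> Mc yM CN.
have inj0 : injective (fun i : 'I_N => (i, j0)) by move=> i i' [].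
have [|i0 ni0] := qindep_exchange c Mc (qindep_inj inj0 yM).
  by rewrite card_ord.
pose P m (phi : {additive R -> rat}) := (forall x, M x -> phi x = 0) /\
  if m == j0 then (forall a, phi (c a) = 0) /\ phi (y (i0, j0)) = 1
  else forall a, phi (y a) = (a == (i0, m))%:R.
have /choice[phi phiP] m : exists phi, P m phi.
  rewrite /P; case: eqVneq => mj.
    have [phi [phi0 phi1]] := additive_functional (qadd_closed c Mc) ni0.
    exists phi; split=> [x Mx|]; first exact/phi0/qadd_sub.
    by split=> // a; exact/phi0/qadd_gen.
  have [phi [phi0 phi1]] :=
    additive_functional (qadd_closed _ Mc) (qindep_sub (j := (i0, m)) Mc yM).
  exists phi; split=> [x Mx|a]; first exact/phi0/qadd_sub.
  have [->|am] := eqVneq a (i0, m); first exact: phi1.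
  by have := phi0 _ (qadd_gen _ a Mc); rewrite am.
have [_] := phiP j0; rewrite eqxx => -[phic phi1].
exists i0, phi; split=> // [m|m mj]; first by have [] := phiP m.
by have [_] := phiP m; rewrite (negbTE mj).
Qed.

Lemma small_combination (R : realType) (p n : nat) (U : 'I_p -> 'cV[int]_n) (e : R) :
  0 < e -> exists2 e' : R, 0 < e' & forall y : 'I_p -> R, (forall j, 0 < y j < e') ->
    forall a, `|(\sum_j y j *: map_mx intr (U j)) a 0| < e.
Proof.
(* The summand 1 makes [K] positive and the final inequality strict. *)
move=> e0; pose K : R := 1 + \sum_j \sum_a `|(U j a 0)%:~R|.
have K1 : 1 <= K by rewrite lerDl; do 2!apply: sumr_ge0 => ? _.
have K0 : 0 < K by exact: lt_le_trans K1.
exists (e / K); first by rewrite divr_gt0.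
move=> y ye a; rewrite summxE (le_lt_trans (ler_norm_sum _ _ _))//.
have : \sum_j `|(y j *: map_mx intr (U j)) a 0| <= e / K * (K - 1).
  rewrite /K [X in _ * X]addrAC subrr add0r mulr_sumr; apply: ler_sum => j _.
  rewrite !mxE normrM; have /andP[y0 yl] := ye j.
  rewrite (gtr0_norm y0); apply: ler_pM => //; [exact: ltW|exact: ltW|].
  by rewrite (bigD1 a)//= lerDl; apply: sumr_ge0.
move=> /le_lt_trans; apply.
rewrite mulrBr mulr1 divfK ?gt_eqF// ltrBlDr ltrDl divr_gt0//.
Qed.

(** * Infinite-dimensionality of the group of 0-cycles *)

Theorem theorem1 (R : realType) (n : nat) (B : ia_manifold R n)
    (B_compact : compact [set: B]) (p : nat) (p_ge2 : (2 <= p)%N)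
    (w : tropical_form B p) (w_neq0 : tf_nonzero w) (k : nat) :
  ~ set_surj [set: ('I_k -> B) * ('I_k -> B)] (CH0_hom B) (diff_map B k).
Proof.
move=> surj.
have [At [T [At_sub At_cover cT At_tr]]] := countable_subatlas B.
have [c [b [V [ac cb wV]]]] := w_neq0.
have [d ad db] := At_cover b.
have [U wU] : exists U, w d b U != 0.
  have [A [x0 [uA cd]]] := ia_transition ac (At_sub _ ad) cb db.
  exists (fun i => A *m V i).
  by rewrite -(tf_transition w ac (At_sub _ ad) cb db uA cd).
(* A functional that kills the span [M] of these numbers kills the translation parts and also the
   coordinates of [b], so [b] will have value zero. *)
have [u uT] : exists u : nat -> R,
    T `|` [set d b j 0 | j in [set: 'I_n]] `<=` range u.
  apply: countable_enum; rewrite -bigcup2E.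
  apply: bigcup_countable => // -[|[|i]] _ //=.
  exact: card_le_trans (card_image_le _ _) (countableP _).
pose M := qspan u.
have Mc : qclosed M := qspan_closed u.
have cM : countable M := qspan_countable u.
have TM x : T x -> M x.
  by move=> Tx; have [i _ <-] := uT x (or_introl Tx); exact: qspan_gen.
have dM j : M (d b j 0).
  have [|i _ <-] := uT (d b j 0); first by right; exists j.
  exact: qspan_gen.
(* [C] indexes the coordinates of [2 k] points, and [N] exceeds their number by one, as the exchange
   lemma demands. *)
pose C : finType := (('I_k * 'I_n) + ('I_k * 'I_n))%type.
pose N := #|C|.+1.
have nN : nbhs b [set y | w d y = w d b] := tf_locally_constant w (At_sub _ ad) db.
have [e e0 box] := chart_box (At_sub _ ad) db nN.
have [e' e'0 small] := small_combination U e0.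
have [y [yM ye]] := qindep_exists ('I_N * 'I_p)%type Mc cM e'0.
(* The point [pt i] is [b] displaced by small multiples of the vectors [U j], on which [w] is
   nonzero; it stays where [w] is constant in the chart [d]. *)
have /fin_all_exists[pt ptP] (i : 'I_N) : exists x, [/\ w d x = w d b, cdom d x &
    d x = d b + \sum_j y (i, j) *: map_mx intr (U j)].
  apply: box => a; 
  rewrite [X in `|X - _|]mxE [X in `|X|]addrC addKr.
  by apply: small => j; exact: ye.
pose z : {freeg B} := \sum_(i < N) (<< pt i >> - << b >>).
have degz : deg z = 0.
  by rewrite /z raddf_sum big1 // => i _; rewrite raddfB /= !degU subrr.
have [cc _ ccz] := surj (ch0 z) (ex_intro2 _ _ z degz erefl).
have /choice[ch chP] x : exists c', At c' /\ cdom c' x.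
  by have [c' ? ?] := At_cover x; exists c'.
pose co (a : C) : R := match a with
  | inl a => ch (cc.1 a.1) (cc.1 a.1) a.2 0
  | inr a => ch (cc.2 a.1) (cc.2 a.1) a.2 0 end.
pose j0 : 'I_p := Ordinal (ltnW p_ge2).
(* The slot [j0] will annihilate the [2 k] given points; the second slot [j1] will annihilate every
   [pt i] except [pt i0]. *)
pose j1 : 'I_p := Ordinal p_ge2.
have j10 : j1 != j0 by [].
have [i0 [phi [phiM phico phi1 phiy]]] :=
  test_functionals co j0 Mc yM (leqnn _).
have AtP : killed_atlas At phi.
  split=> // c' d' x ac' ad' cx dx.
  have [A [x0 [uA cd' x0T]]] := At_tr _ _ _ ac' ad' cx dx.
  by exists A, x0; split=> // i j; exact/phiM/TM.
have zE : cycle_value w At phi z =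
    cycle_value w At phi (\sum_(j < k) (<< cc.1 j >> - << cc.2 j >>)).
  apply: cycle_value_ch0 => //; rewrite -ccz /diff_map raddf_sum.
  by apply: eq_bigr => j _; rewrite raddfB.
have fv0 c' x i : At c' -> cdom c' x -> phi_coord phi c' x i = 0 ->
    form_value w At phi x = 0.
  move=> ac' cx px; rewrite (form_valueE w AtP ac' cx).
  by apply: mlin_coord0 px; exact: (form_at_mlin w AtP ac' cx).
(* [phi j0] kills all chart coordinates of these points, so the form has a zero argument at each of
   them. *)
have ccE : cycle_value w At phi (\sum_(j < k) (<< cc.1 j >> - << cc.2 j >>)) = 0.
  rewrite raddf_sum big1 // => j _; rewrite raddfB /= !cycle_valueU.
  have [a1 d1] := chP (cc.1 j); have [a2 d2] := chP (cc.2 j).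
  rewrite (fv0 _ _ j0 a1 d1) ?(fv0 _ _ j0 a2 d2) ?subr0//.
    by apply/colP => a; rewrite !mxE; exact: (phico (inr (j, a))).
  by apply/colP => a; rewrite !mxE; exact: (phico (inl (j, a))).
have coordE i m : phi_coord phi d (pt i) m =
    \sum_j phi m (y (i, j)) *: map_mx intr (U j).
  have [_ _ dE] := ptP i; rewrite /phi_coord dE.
  apply/colP => a; rewrite !mxE raddfD /= phiM// add0r.
  rewrite !summxE raddf_sum; apply: eq_bigr => j _.
  by rewrite !mxE /= additive_mulrint.
have b0 : form_value w At phi b = 0.
  apply: (fv0 d b j0 ad db); apply/colP => a; rewrite !mxE; exact/phiM/dM.
have zE' : cycle_value w At phi z = form_value w At phi (pt i0).
  rewrite raddf_sum (bigD1 i0)//= raddfB /= !cycle_valueU b0 subr0 big1 ?addr0//.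
  move=> i ii0; rewrite raddfB /= !cycle_valueU b0 subr0.
  have [_ di _] := ptP i; apply: (fv0 d (pt i) j1 ad di).
  rewrite coordE big1// => j _; rewrite phiy// xpair_eqE (negbTE ii0) scale0r//.
have [wi di _] := ptP i0.
(* At [pt i0] the argument in a slot [m] other than [j0] is [U m]; in the slot [j0] it is a
   combination of the [U j] in which [U j0] has coefficient 1. *)
have : form_value w At phi (pt i0) = (w d b U)%:~R.
  rewrite (form_valueE w AtP ad di) /form_at wi.
  have fM := tf_multilinear w (At_sub _ ad) db.
  have -> : phi_coord phi d (pt i0) = dfwith (fun m => map_mx intr (U m)) j0
      (\sum_j phi j0 (y (i0, j)) *: map_mx intr (U j)).
    apply/funext => m; have [<-|mj] := eqVneq j0 m.
      by rewrite dfwithin coordE.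
    rewrite dfwithout//; rewrite eq_sym in mj; rewrite coordE (bigD1 m)//= phiy//.
    rewrite eqxx scale1r big1 ?addr0// => j jm; rewrite phiy// xpair_eqE.
    by rewrite (negbTE jm) andbF scale0r.
  rewrite malt_combination//; last 2 first.
  - exact: ratext_mlin.
  - exact: ratext_alt fM (tf_alternating w (At_sub _ ad) db).
  have := ratext_int fM 1 U; rewrite expr1n mul1r => <-.
  by congr ratext; apply/funext => m; rewrite scale1r.
move/eqP; rewrite -zE' zE ccE eq_sym intr_eq0; exact/negP.
Qed.
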